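(* Let $G$ be a connected graph of diameter $3$ with at least one minimal vertex separator of cardinality $2$. If $\lambda_2(G) < -1/2$, then $G$ is (isomorphic to) a connected induced subgraph of $Pt_1$ or of a triple block graph $Pt_2(p,q)$ for some integers $p,q\ge 2$.
   Context: All graphs are finite, simple and connected. $d_G(u,v)$ is the length of a shortest path between $u$ and $v$, and $\mathrm{diam}(G)$ is the maximum of $d_G(u,v)$. The distance matrix of $G$ with vertices $v_1,\dots,v_n$ is $\mathbf{D}(G)=[d_G(v_i,v_j)]$; its (real) eigenvalues, counted with multiplicity, are ordered $\lambda_1(G)\ge\lambda_2(G)\ge\cdots\ge\lambda_n(G)$. For non-adjacent vertices $u,v$, a set $S$ of vertices is a $uv$-separator if removing $S$ puts $u$ and $v$ in distinct connected components; it is a minimal $uv$-separator if no proper subset of $S$ is a $uv$-separator. A minimal vertex separator (mvs) is a set that is a minimal $uv$-separator for some pair of non-adjacent vertices $u,v$. A block of a graph is a maximal connected subgraph that has no cut vertex. The diamond is $K_4$ minus one edge. The full house is the 5-vertex graph consisting of a $K_4$ together with one further vertex adjacent to exactly two vertices of the $K_4$. Each of these two graphs has exactly one minimal vertex separator, of cardinality $2$: in the diamond, the two vertices of degree $3$; in the full house, the two vertices of degree $4$. $Pt_1$ is the graph with $9$ vertices $o,p,q,r,t,s,x,y,z$ and edges $op, or, oq, pr, pq, qr, tp, tr, sp, rx, ry, rz, yz$ (a full house whose mvs is $\{p,r\}$, with one pendant edge attached at $p$, and one pendant edge and one triangle attached at $r$). For integers $p,q\ge 2$, a triple block graph $Pt_2(p,q)$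 is a graph with exactly three blocks: one is a full house (or a diamond), the other two are cliques $K_p$ and $K_q$, and these two cliques are attached to the full house (or diamond) at the two distinct vertices of its mvs of cardinality $2$: $K_p$ shares with it exactly one of these two vertices and $K_q$ shares with it exactly the other one. *)

(* Defs.v *)
From mathcomp Require Import all_boot all_order all_algebra.
From mathcomp Require Import polyrcf.

Set Implicit Arguments.
Unset Strict Implicit.
Unset Printing Implicit Defensive.

Import Order.TTheory GRing.Theory Num.Theory.
Local Open Scope ring_scope.

Definition simple_graph (T : finType) (e : rel T) : Prop :=
  symmetric e /\ irreflexive e.

(* The empty graph is not connected. *)
Definition connected_graph (T : finType) (e : rel T) : bool :=
  (0 < #|T|)%N && [forall x, forall y, connect e x y].

Definition induced (T : finType) (e : rel T) (A : {set T}) :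
    rel {x : T | x \in A} :=
  fun x y => e (val x) (val y).
Arguments induced {T} e A x y.

Definition graph_iso (T T' : finType) (e : rel T) (e' : rel T') : Prop :=
  exists2 f : T -> T', bijective f & forall x y, e' (f x) (f y) = e x y.

Definition conn_induced_subgraph (T U : finType) (e : rel T) (h : rel U) :
    Prop :=
  exists2 A : {set U}, connected_graph (induced h A)
    & graph_iso e (induced h A).

(* The least length of a path from u to v; the junk value #|T| is taken when
   there is none. *)
Definition gdist (T : finType) (e : rel T) (u v : T) : nat :=
  find (fun n => [exists p : n.-tuple T,
                    [&& path e u p, last u p == v & uniq (u :: p)]])
       (iota 0 #|T|).

Definition diam (T : finType) (e : rel T) : nat :=
  \max_(u : T) \max_(v : T) gdist e u v.

Definition distmx (R : pzSemiRingType) (T : finType) (e : rel T) :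
    'M[R]_#|T| :=
  \matrix_(i, j) (gdist e (enum_val i) (enum_val j))%:R.

(* The eigenvalues of A in R, in nonincreasing order; each is repeated
   according to its multiplicity as a root of the characteristic polynomial. *)
Definition eigenvalues (R : rcfType) (n : nat) (A : 'M[R]_n) : seq R :=
  sort >=%R
    (flatten [seq nseq (mup a (char_poly A)) a | a <- rootsR (char_poly A)]).

(* lambda_k is the k-th largest eigenvalue for k >= 1, hence at position k.-1 *)
Definition dist_lambda (R : rcfType) (k : nat) (T : finType) (e : rel T) : R :=
  (eigenvalues (distmx R e))`_k.-1.

(* Isolates the vertices of S instead of deleting them, so that the type of
   vertices is unchanged. *)
Definition remove (T : finType) (e : rel T) (S : {set T}) : rel T :=
  fun x y => [&& x \notin S, y \notin S & e x y].

Definition separator (T : finType) (e : rel T) (u v : T) (S : {set T}) : bool :=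
  [&& u \notin S, v \notin S & ~~ connect (remove e S) u v].

Definition mvs (T : finType) (e : rel T) (S : {set T}) : bool :=
  [exists u, exists v, [&& u != v, ~~ e u v & minset (separator e u v) S]].

Definition cut_vertex (T : finType) (e : rel T) (c : T) : bool :=
  [exists x, exists y, [&& x != c, y != c, connect e x y
                         & ~~ connect (remove e [set c]) x y]].

(* A block is given by its vertex set: adding edges between vertices of a
   connected graph without cut vertex preserves these properties, so that a
   maximal such subgraph is an induced one. *)
Definition block (T : finType) (e : rel T) (B : {set T}) : bool :=
  maxset (fun C : {set T} => connected_graph (induced e C)
                             && [forall c, ~~ cut_vertex (induced e C) c]) B.

Definition clique (T : finType) (e : rel T) (A : {set T}) : bool :=
  [forall x in A, forall y in A, (x != y) ==> e x y].

Definition graph_of_edges (n : nat) (s : seq (nat * nat)) : rel 'I_n :=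
  fun i j => ((val i, val j) \in s) || ((val j, val i) \in s).

Definition diamond : rel 'I_4 :=
  @graph_of_edges 4 [:: (0, 1); (0, 2); (0, 3); (1, 2); (1, 3)]%N.

Definition full_house : rel 'I_5 :=
  @graph_of_edges 5
    [:: (0, 1); (0, 2); (0, 3); (1, 2); (1, 3); (2, 3); (4, 0); (4, 1)]%N.

(* The vertices o, p, q, r, t, s, x, y, z are 0, 1, 2, 3, 4, 5, 6, 7, 8. *)
Definition Pt1 : rel 'I_9 :=
  @graph_of_edges 9
    [:: (0, 1); (0, 3); (0, 2); (1, 3); (1, 2); (2, 3); (4, 1); (4, 3);
        (5, 1); (3, 6); (3, 7); (3, 8); (7, 8)]%N.

Definition triple_block_graph (p q : nat) (U : finType) (h : rel U) : Prop :=
  [/\ simple_graph h, connected_graph h &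
    exists B0 B1 B2 : {set U},
      [/\ [set B | block h B] = [set B0; B1; B2] /\ uniq [:: B0; B1; B2],
          graph_iso full_house (induced h B0)
            \/ graph_iso diamond (induced h B0),
          clique h B1 /\ #|B1| = p,
          clique h B2 /\ #|B2| = q
        & exists2 S : {set {x : U | x \in B0}},
            mvs (induced h B0) S & exists a b : U,
              [/\ a != b, val @: S = [set a; b],
                  B0 :&: B1 = [set a] & B0 :&: B2 = [set b]]]].

(* Main.v *)
(** If [lambda_2 < -1/2], then [2D + I] is negative on a hyperplane, so it is
    indefinite on the span of any coordinate vector [e_o] (where it takes the
    value [1]) and any other vector [c].  Hence, for each integer vector [c] off
    [o], [2 c D c + c c < 4 (sum_x c_x d(o, x))^2], and explicit [(o, c)] exclude
    a dozen small induced subgraphs, starting with [C4] and [P5].  In a minimal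
    [uv]-separator [{a, b}], these exclusions force [a] and [b] to be adjacent
    and to have common neighbours [p], [q] in the components of [u] and of [v].
    Every other vertex is then adjacent to [a] or [b].  At most one is adjacent
    to both, and the neighbours of only [a] (resp. only [b]) form a clique, or
    else [K1 + K1] or [K1 + K2] with a single vertex on the other side.  The
    first case is a triple block graph, the second embeds in [Pt1]. *)

Require Import Defs.
From mathcomp Require Import all_boot all_order all_algebra.
From mathcomp Require Import polyrcf complex spectral sesquilinear.
From mathcomp Require Import ring lra.
Import Order.TTheory GRing.Theory Num.Theory.

Set Implicit Arguments.
Unset Strict Implicit.
Unset Printing Implicit Defensive.

(** The obstacle is that the distances between the vertices of an induced subgraph are those of the
    whole graph: a shortest path may leave the subgraph, so adjacency alone does not tell distance 2
    from distance 3. Hence the first thing to be proved is that the ends of an induced P4 are at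
    distance 3; the other exclusions rest on it.

    Since [c] is supported on a few vertices, the inequality involves only the distances among them.
    Each exclusion is then a finite computation, however large the graph. The factor 2 in [2D + I]
    clears the denominator of 1/2, so that the computation takes place in the integers and does not
    depend on the real closed field.

    The integer vectors are certificates: they need no derivation, and any other vector that
    violates the inequality would serve as well. *)

(** * Symmetric matrices whose second eigenvalue lies below a threshold *)

Section Spectral.
Local Open Scope ring_scope.

Lemma char_poly_conj (F : fieldType) (n : nat) (P D : 'M[F]_n) :
  P \in unitmx -> char_poly (invmx P *m D *m P) = char_poly D.
Proof.
move=> Pu; have eP : map_mx polyC (invmx P) *m map_mx polyC P = 1%:M.
  by rewrite -map_mxM mulVmx // map_mx1.
rewrite /char_poly /char_poly_mx.
have -> : 'X%:M - map_mx polyC (invmx P *m D *m P) =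
    map_mx polyC (invmx P) *m ('X%:M - map_mx polyC D) *m map_mx polyC P.
  rewrite mulmxBr mulmxBl !map_mxM /= scalar_mxC.
  by rewrite -['X%:M *m _ *m _]mulmxA eP mulmx1.
by rewrite !det_mulmx mulrAC -det_mulmx eP det1 mul1r.
Qed.

Lemma eigenvalues_prod (R : rcfType) (n : nat) (A : 'M[R]_n) (s : seq R) :
  char_poly A = \prod_(a <- s) ('X - a%:P) -> perm_eq (eigenvalues A) s.
Proof.
move=> eA; rewrite /eigenvalues perm_sort eA.
have p_neq0 : \prod_(a <- s) ('X - a%:P) != 0 :> {poly R}.
  by rewrite monic_neq0 ?monic_prod_XsubC.
apply/allP => x _ /=; rewrite count_flatten -map_comp sumnE big_map.
under eq_bigr => a _ do rewrite /= count_nseq mu_prod_XsubC /= [a == x]eq_sym.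
have xroots : x \in rootsR (\prod_(a <- s) ('X - a%:P)) = (x \in s).
  have := roots_on_rootsR p_neq0 x; rewrite in_itv /= => <-.
  by rewrite root_prod_XsubC.
rewrite big_mkcond /=; have [xs|xs] := boolP (x \in s).
  rewrite (bigD1_seq x) ?uniq_roots ?xroots //= eqxx mul1n big1 ?addn0 //.
  by move=> a; rewrite eq_sym => /negPf->.
rewrite big_seq big1 ?(count_memPn xs) // => a.
by have [<-|] := eqVneq x a; rewrite ?xroots ?(negPf xs).
Qed.

Section SecondEigenvalue.
Variables (R : rcfType) (n : nat) (A : 'M[R]_n) (t : R).
Hypotheses (A_sym : A^T = A) (lt_t : (eigenvalues A)`_1 < t).

Local Notation C := R[i].
Local Notation toC := (real_complex R).

(** In the sorted list only the head can reach [t], and counting is invariant under permutation.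
    Positions are compared instead of values, so that a multiple eigenvalue counts with its
    multiplicity. *)
Lemma eigenvalues_ge_uniq (s : seq R) (i j : nat) :
    perm_eq (eigenvalues A) s ->
  (i < j < size s)%N -> t <= s`_i -> t <= s`_j -> False.
Proof.
move=> es /andP[ij js] ti tj.
have : (1 < count (>= t) s)%N.
  rewrite -(cat_take_drop j s) count_cat (drop_nth 0) //= tj.
  rewrite addnCA add1n ltnS addn_gt0 -has_count; apply/orP; left.
  apply/hasP; exists s`_i => //; rewrite -(nth_take _ ij) mem_nth //.
  by rewrite size_takel // ltnW.
rewrite -(permP es).
have : sorted >=%R (eigenvalues A) by apply: sort_sorted => x y; apply: le_total.
case: (eigenvalues A) lt_t => [|x [|y r]] /=; rewrite ?addn0; first by [].
  by case: (t <= x).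
move=> yt /andP[_ yr]; rewrite [t <= y]leNgt yt /= add0n.
have /eqP -> : count (>= t) r == 0%N; last by case: (t <= x).
rewrite -leqn0 leqNgt -has_count -all_predC; apply/allP => z zr /=.
rewrite -ltNge; apply: le_lt_trans yt.
by have /allP/(_ _ zr) := order_path_min (rev_trans le_trans) yr.
Qed.

(** Over [R[i]] a real symmetric matrix is Hermitian, so it has a unitary diagonalisation with real
    diagonal [s]. Comparing characteristic polynomials identifies [s] with [eigenvalues A] up to
    order. The last clause yields the hyperplane: the zero set of the single coordinate, if any,
    whose coefficient reaches [t]. *)
Lemma spectral_form :
  exists (P : 'M[C]_n) (s : 'I_n -> R),
    [/\ P \in unitmx,
     (forall z : 'rV[C]_n, (z *m (map_mx toC A) *m (map_mx Num.conj z)^T) 0 0 =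
        \sum_i toC (s i) * `|(z *m P) 0 i| ^+ 2),
     (forall z : 'rV[C]_n, (z *m (map_mx Num.conj z)^T) 0 0 =
        \sum_i `|(z *m P) 0 i| ^+ 2)
     & forall i j, t <= s i -> t <= s j -> i = j].
Proof.
have Ah : map_mx toC A \is hermsymmx.
  apply: realsym_hermsym.
    by apply/is_hermitianmxP; rewrite expr0 scale1r map_mx_id // map_trmx A_sym.
  by apply/mxOverP => i j; rewrite mxE complex_real.
have eA := orthomx_spectralP (hermitian_normalmx Ah).
have /mxOverP dR := hermitian_spectral_diag_real Ah.
have Pu := spectral_unitarymx (map_mx toC A).
move: eA; set P := spectralmx _ in Pu *; set d := spectral_diag _ in dR * => eA.
pose s i := complex.Re (d 0 i).
have ds i : d 0 i = toC (s i) by rewrite RRe_real.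
have Pinv : invmx P = (map_mx Num.conj P)^T by rewrite invmx_unitary // map_trmx.
have eP (z : 'rV[C]_n) :
    (map_mx Num.conj (z *m invmx P))^T = P *m (map_mx Num.conj z)^T.
  by rewrite Pinv map_mxM trmx_mul -map_trmx trmxK -map_mx_comp
    (map_mx_id (@conjCK _)).
exists (invmx P), s; split.
- by rewrite unitmx_inv unitarymx_unit.
- move=> z; rewrite eA !mulmxA -[_ *m P *m _]mulmxA -eP mxE.
  apply: eq_bigr => i _; rewrite mul_mx_diag mxE ds.
  rewrite [(map_mx _ _)^T i 0]mxE [map_mx _ _ 0 i]mxE normCK; ring.
- move=> z; rewrite -{1}[z]mulmx1 -(mulVmx (unitarymx_unit Pu)) mulmxA.
  rewrite -mulmxA -eP mxE; apply: eq_bigr => i _.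
  by rewrite [(map_mx _ _)^T i 0]mxE [map_mx _ _ 0 i]mxE normCK.
- have cA : char_poly A = \prod_(a <- [seq s i | i <- enum 'I_n]) ('X - a%:P).
    apply: (map_poly_inj toC); rewrite map_char_poly eA.
    rewrite char_poly_conj ?unitarymx_unit // char_poly_trig ?diag_mx_is_trig //.
    rewrite rmorph_prod big_map big_enum /=; apply: eq_bigr => i _.
    by rewrite rmorphB /= map_polyX map_polyC /= mxE eqxx mulr1n ds.
  move=> i j ti tj; apply/val_inj; wlog ij : i j ti tj / (i <= j)%N.
    by move=> H; case/orP: (leq_total i j) => /H ->.
  apply/eqP; rewrite eqn_leq ij leqNgt; apply/negP => ltij.
  have nths (k : 'I_n) : [seq s i | i <- enum 'I_n]`_k = s k.
    by rewrite (nth_map k) ?size_enum_ord // nth_ord_enum.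
  have := @eigenvalues_ge_uniq _ i j (eigenvalues_prod cA).
  by rewrite !nths size_map size_enum_ord ltij ltn_ord => /(_ isT ti tj).
Qed.

Local Notation form x y := ((x *m (A - t%:M) *m y^T) 0 0).

(** This is a reversed Cauchy-Schwarz inequality. The entries at [i] and [j] make [x] and [y]
    independent, so their span is a plane and contains a nonzero vector of the hyperplane, where the
    form is negative. As the form is positive at [x], its determinant on the plane is negative. *)
Lemma form_indefinite (x y : 'rV[R]_n) (i j : 'I_n) :
    x 0 i != 0 -> y 0 i = 0 -> y 0 j != 0 -> 0 < form x x ->
  form x x * form y y < form x y ^+ 2.
Proof.
move=> xi yi yj xx_gt0; rewrite ltNge; apply/negP => disc.
have [P [s [Pu formA form1 s_lt]]] := spectral_form.
pose X := map_mx toC x; pose Y := map_mx toC y.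
have form_sym : form y x = form x y.
  have -> : form y x = ((y *m (A - t%:M) *m x^T)^T) 0 0 by rewrite [RHS]mxE.
  by rewrite !trmx_mul trmxK linearB /= A_sym tr_scalar_mx mulmxA.
have toC_form (u v : 'rV[R]_n) :
  (map_mx toC u *m map_mx toC A *m (map_mx toC v)^T) 0 0
    - toC t * (map_mx toC u *m (map_mx toC v)^T) 0 0 = toC (form u v).
  rewrite map_trmx -!map_mxM ![map_mx toC _ 0 0]mxE -rmorphM -rmorphB /=.
  congr (toC _); rewrite mulmxBr mulmxBl mul_mx_scalar -scalemxAl.
  rewrite [RHS]mxE; congr (_ + _).
  by rewrite [RHS]mxE; congr (- _); rewrite [RHS]mxE.
have conjX (u : 'rV[R]_n) : map_mx Num.conj (map_mx toC u) = map_mx toC u.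
  by apply/matrixP => k l; rewrite !mxE; apply: CrealP; rewrite complex_real.
have bilinE (M : 'M[C]_n) (a b c d : C) (u v : 'rV[C]_n) (u' v' : 'cV[C]_n) :
    ((a *: u + b *: v) *m M *m (c *: u' + d *: v')) 0 0 =
    a * c * (u *m M *m u') 0 0 + a * d * (u *m M *m v') 0 0
      + b * c * (v *m M *m u') 0 0 + b * d * (v *m M *m v') 0 0.
  have addE (B D : 'M[C]_1) : (B + D) 0 0 = B 0 0 + D 0 0 by rewrite mxE.
  have scaleE k (B : 'M[C]_1) : (k *: B) 0 0 = k * B 0 0 by rewrite mxE.
  by rewrite !(mulmxDl, mulmxDr) -!(scalemxAl, scalemxAr) !addE !scaleE; ring.
have formE (a b : C) (z := a *: X + b *: Y) :
    \sum_k toC (s k - t) * `|(z *m P) 0 k| ^+ 2 =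
    `|a| ^+ 2 * toC (form x x) + (a * b^* + a^* * b) * toC (form x y)
      + `|b| ^+ 2 * toC (form y y).
  transitivity ((z *m map_mx toC A *m (map_mx Num.conj z)^T) 0 0
      - toC t * (z *m (map_mx Num.conj z)^T) 0 0).
    rewrite formA form1 mulr_sumr -sumrB; apply: eq_bigr => k _.
    by rewrite rmorphB mulrBl.
  have -> : (map_mx Num.conj z)^T = a^* *: X^T + b^* *: Y^T.
    by rewrite map_mxD !map_mxZ !conjX linearD !linearZ.
  rewrite mulrDl -{2}form_sym -!toC_form -/X -/Y !normCK.
  rewrite -[in X in _ - X](mulmx1 z) /z !bilinE !mulmx1; ring.
(* The combination is chosen to cancel the only coordinate [k] with [t <= s k]. *)
have [a [b [ab0 zP0]]] : exists a b : C, (a != 0) || (b != 0) /\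
    forall k, t <= s k -> ((a *: X + b *: Y) *m P) 0 k = 0.
  have [k tk | none] := pickP (fun k => t <= s k); last first.
    by exists 1, 0; split; [rewrite oner_eq0 | move=> k; rewrite none].
  have zk a b : ((a *: X + b *: Y) *m P) 0 k =
      a * (X *m P) 0 k + b * (Y *m P) 0 k.
    by rewrite mulmxDl -!scalemxAl !mxE.
  have [u0|u0] := eqVneq ((X *m P) 0 k) 0.
    exists 1, 0; split=> [|l tl]; first by rewrite oner_eq0.
    by rewrite -(s_lt _ _ tk tl) zk u0 mulr0 mul0r addr0.
  exists ((Y *m P) 0 k), (- (X *m P) 0 k); rewrite oppr_eq0 u0 orbT; split=> //.
  by move=> l tl; rewrite -(s_lt _ _ tk tl) zk; ring.
have z0 : a *: X + b *: Y != 0.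
  apply: contraTneq ab0 => /rowP z0.
  have a0 : a = 0.
    have /eqP := z0 i; rewrite !mxE yi rmorph0 mulr0 addr0 mulf_eq0.
    by rewrite (fmorph_eq0 toC) (negPf xi) orbF => /eqP.
  have /eqP := z0 j; rewrite a0 !mxE mul0r add0r mulf_eq0 (fmorph_eq0 toC).
  by rewrite (negPf yj) orbF eqxx /= negbK.
have [k zk] : exists k, ((a *: X + b *: Y) *m P) 0 k != 0.
  apply/existsP; rewrite -negb_forall; apply: contra z0 => /forallP z0.
  rewrite -(mulmxK Pu (_ + _)); apply/eqP; apply/rowP => k.
  rewrite mxE big1 ?mxE // => l _; by rewrite (eqP (z0 l)) mul0r.
have : \sum_k toC (s k - t) * `|((a *: X + b *: Y) *m P) 0 k| ^+ 2 < 0.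
  rewrite (bigD1 k) //= -[X in _ < X]addr0 ltr_leD //.
    rewrite pmulr_llt0 ?exprn_gt0 ?normr_gt0 // (ltcR _ 0) subr_lt0 ltNge.
    by apply: contra zk => /zP0 ->.
  apply: sumr_le0 => l _; have [/zP0 ->|sl] := leP t (s l).
    by rewrite normr0 expr0n mulr0.
  by rewrite mulr_le0_ge0 ?exprn_ge0 // (lecR _ 0) subr_le0 ltW.
rewrite formE -(pmulr_rlt0 (x := toC (form x x))) ?(ltcR 0) //.
(* Completing the square: under [disc] both summands are nonnegative. *)
suff -> : toC (form x x) * (`|a| ^+ 2 * toC (form x x) +
      (a * b^* + a^* * b) * toC (form x y) + `|b| ^+ 2 * toC (form y y)) =
    `|a * toC (form x x) + b * toC (form x y)| ^+ 2 +
      `|b| ^+ 2 * toC (form x x * form y y - form x y ^+ 2).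
  move/lt_geF; rewrite addr_ge0 ?exprn_ge0 // mulr_ge0 ?exprn_ge0 //.
  by rewrite (lecR 0) subr_ge0.
have cJ (r : R) : (toC r)^* = toC r by apply: CrealP; rewrite complex_real.
rewrite !normCK rmorphB rmorphXn [(_ + _)^*]rmorphD !rmorphM /= !cJ; ring.
Qed.
End SecondEigenvalue.

End Spectral.

(** * Graph distance *)

Section Distance.
Variables (T : finType) (e : rel T).
Local Notation d := (gdist e).

Lemma gdist_le (x : T) (p : seq T) :
  path e x p -> uniq (x :: p) -> (d x (last x p) <= size p)%N.
Proof.
move=> ep up; have ltT : (size p < #|T|)%N.
  by have := max_card (mem (x :: p)); rewrite (card_uniqP up).
rewrite leqNgt; apply/negP => /(before_find 0%N).
rewrite nth_iota // add0n => /existsP[]; exists (in_tuple p).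
by rewrite ep up eqxx.
Qed.

Lemma gdist_path (x y : T) : (d x y < #|T|)%N ->
  exists p : seq T, [/\ path e x p, last x p = y, uniq (x :: p) & size p = d x y].
Proof.
move=> lt_d; have : has (fun n => [exists p : n.-tuple T,
    [&& path e x p, last x p == y & uniq (x :: p)]]) (iota 0 #|T|).
  by rewrite has_find size_iota.
move=> /(nth_find 0%N); rewrite -/(d x y) nth_iota // add0n.
by move=> /existsP[p /and3P[ep /eqP lp up]]; exists p; rewrite size_tuple.
Qed.

Lemma gdistxx (x : T) : d x x = 0%N.
Proof. by apply/eqP; rewrite -leqn0; apply: (@gdist_le x [::]). Qed.

Lemma gdist1 (x y : T) : irreflexive e -> e x y -> d x y = 1%N.
Proof.
move=> irr exy; have nxy : x != y by apply: contraTneq exy => ->; rewrite irr.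
apply/eqP; rewrite eqn_leq (@gdist_le x [:: y]) /= ?exy ?inE ?nxy //.
rewrite lt0n; apply: contra nxy => /eqP d0.
have [|p [_ lp _ /eqP]] := @gdist_path x y; rewrite d0.
  by apply/card_gt0P; exists x.
by rewrite size_eq0 => /eqP p0; rewrite -lp p0.
Qed.

Lemma gdist_gt1 (x y : T) : x != y -> ~~ e x y -> (1 < d x y)%N.
Proof.
move=> nxy nexy; rewrite ltnNge; apply: contra nexy => le1.
(* With at least two vertices, a distance of at most 1 is below the junk value, hence realised by a
   path. *)
have lt2 : (1 < #|T|)%N.
  by have := max_card (mem [:: x; y]); rewrite (card_uniqP _) //= inE nxy.
have [|p [ep lp _ sp]] := @gdist_path x y; first exact: leq_ltn_trans lt2.
move: le1; rewrite -sp; case: p ep lp {sp} => [|z [|//]] /=.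
  by move=> _ xy; rewrite xy eqxx in nxy.
by rewrite andbT => exz <-.
Qed.

Lemma gdist_le2 (x z y : T) : x != y -> e x z -> e z y -> irreflexive e ->
  (d x y <= 2)%N.
Proof.
move=> nxy exz ezy irr; apply: (@gdist_le x [:: z; y]); rewrite /= ?exz ?ezy //.
rewrite !inE negb_or nxy !andbT; apply/andP; split.
  by apply: contraTneq exz => ->; rewrite irr.
by apply: contraTneq ezy => ->; rewrite irr.
Qed.

Lemma gdist2 (x z y : T) : irreflexive e -> x != y -> ~~ e x y ->
  e x z -> e z y -> d x y = 2%N.
Proof.
move=> irr nxy nexy exz ezy; apply/eqP.
by rewrite eqn_leq (gdist_le2 nxy exz ezy) // gdist_gt1.
Qed.

Lemma leq_diam (x y : T) : (d x y <= diam e)%N.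
Proof.
by apply: leq_trans (leq_bigmax x); apply: (leq_bigmax (F := d x) y).
Qed.

Lemma gdistC (x y : T) : symmetric e -> d x y = d y x.
Proof.
move=> sym; suff le_d u v : (d v u <= d u v)%N by apply/eqP; rewrite eqn_leq !le_d.
(* The junk value bounds every distance, so only the case of a genuine path remains, and that path
   is reversed. *)
have [lt_d|] := ltnP (d u v) #|T|; last first.
  by apply: leq_trans; rewrite -[leqRHS](size_iota 0) find_size.
have [p [ep lp up <-]] := gdist_path lt_d.
have -> : u = last v (rev (belast u p)).
  by case: p lp {ep up} => //= z p _; rewrite rev_cons last_rcons.
rewrite -(size_belast u p) -size_rev; apply: gdist_le.
  by rewrite -lp rev_path (eq_path (e' := e)) // => a b; apply: sym.
by rewrite -lp -rev_rcons -lastI rev_uniq.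
Qed.

End Distance.

(** * The integer inequality forced by the second eigenvalue *)

Section LorentzForm.
Local Open Scope ring_scope.

Fixpoint wsum (T : Type) (f : T -> nat) (l : seq (T * int)) : int :=
  if l is (x, c) :: r then c * (f x)%:Z + wsum f r else 0.

(* The value at [c] of the quadratic form [2D + I], where [c] has the entries
   listed in [l]; this needs distinct indices and [d x x = 0]. *)
Fixpoint wpairs (T : Type) (d : T -> T -> nat) (l : seq (T * int)) : int :=
  if l is (x, c) :: r then c ^+ 2 + 4 * c * wsum (d x) r + wpairs d r else 0.

(* [2D + I] has a negative determinant on the span of [e_o] and [c]. *)
Definition lorentz (T : Type) (d : T -> T -> nat) (o : T) (l : seq (T * int)) :=
  wpairs d l < 4 * wsum (d o) l ^+ 2.

Section Form.
Variables (R : rcfType) (T : finType) (e : rel T).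
Hypotheses (e_sym : symmetric e) (lambda2 : dist_lambda R 2 e < - (1 / 2)).
Local Notation d := (gdist e).

(** This is [form_indefinite] at [t = -1/2] for [e_o] and the vector listed in [l]. On [D + I/2] the
    two squares are [1/2] and [wpairs d l / 2]; the mixed term is [wsum (d o) l], because [o] is not
    in the support. Multiplying by 4 gives [lorentz]. *)
Lemma lambda2_lorentz (o : T) (l : seq (T * int)) :
    uniq (o :: unzip1 l) -> has (fun c => c != 0) (unzip2 l) -> lorentz d o l.
Proof.
move=> /= /andP[ol ul] l0.
have d_tr : (distmx R e)^T = distmx R e.
  by apply/matrixP => i j; rewrite !mxE gdistC.
have sumE (F : T -> R) : \sum_(i < #|T|) F (enum_val i) = \sum_x F x.
  by rewrite -(big_enum_val F).
pose vec (f : T -> R) : 'rV[R]_#|T| := \row_j f (enum_val j).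
pose A := distmx R e - (- (1 / 2))%:M.
pose form (f g : T -> R) :=
  \sum_x f x * (\sum_y g y * (d x y)%:R) + 1 / 2 * \sum_x f x * g x.
have formE f g : (vec f *m A *m (vec g)^T) 0 0 = form f g.
  rewrite mulmxBr mulmxBl mul_mx_scalar -scalemxAl scaleNr opprK.
  rewrite mxE [in LHS]addrC mxE [form _ _]addrC; congr (_ + _).
    by rewrite mxE -sumE; congr (_ * _); apply: eq_bigr => i _; rewrite !mxE.
  rewrite -mulmxA mxE -sumE; apply: eq_bigr => i _; rewrite mxE; congr (_ * _).
  by rewrite mxE -sumE; apply: eq_bigr => j _; rewrite !mxE mulrC.
pose f1 (x : T) : R := (x == o)%:R.
pose f2 (x : T) : R := \sum_(p <- l) p.2%:~R * (x == p.1)%:R.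
have f1E (h : T -> R) : \sum_x f1 x * h x = h o.
  by rewrite (bigD1 o) //= /f1 eqxx mul1r big1 ?addr0 // => x /negPf->; rewrite mul0r.
have f2E (h : T -> R) : \sum_x f2 x * h x = \sum_(p <- l) p.2%:~R * h p.1.
  under eq_bigr => x _ do rewrite /f2 mulr_suml.
  rewrite exchange_big /=; apply: eq_bigr => p _.
  rewrite (bigD1 p.1) //= eqxx mulr1 big1 ?addr0 // => x /negPf->.
  by rewrite mulr0 mul0r.
have f2o : f2 o = 0.
  rewrite /f2 big_seq big1 // => p pl; have [op|] := eqVneq o p.1; rewrite ?mulr0 //.
  by case/negP: ol; rewrite op (map_f fst pl).
have f2l p : p \in l -> f2 p.1 = p.2%:~R.
  rewrite /f2; elim: l ul {ol l0 f2 f2E f2o} => //= -[x c] r IH /andP[xr ur].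
  rewrite inE big_cons /= => /predU1P[->|pr] /=.
    rewrite eqxx mulr1 big_seq big1 ?addr0 // => q qr; have [xq|] := eqVneq x q.1.
      by case/negP: xr; rewrite xq (map_f fst qr).
    by rewrite mulr0.
  have [px|_] := eqVneq p.1 x; first by case/negP: xr; rewrite -px (map_f fst pr).
  by rewrite mulr0 add0r IH.
have wsumE x r : (wsum (d x) r)%:~R = \sum_(p <- r) p.2%:~R * (d x p.1)%:R :> R.
  elim: r => [|[y c] r IH]; rewrite (big_nil, big_cons) //=.
  by rewrite rmorphD rmorphM /= IH.
(* The double sum runs over ordered pairs, whereas [wpairs] meets each unordered pair once; hence
   its factor 4. *)
have wpairsE r : (wpairs d r)%:~R = \sum_(p <- r) p.2%:~R ^+ 2 +
    2 * \sum_(p <- r) p.2%:~R * (\sum_(q <- r) q.2%:~R * (d p.1 q.1)%:R) :> R.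
  elim: r => [|[y c] r IH]; first by rewrite !big_nil mulr0 addr0.
  rewrite !big_cons /= gdistxx mulr0 add0r rmorphD rmorphD /= IH !rmorphM /= wsumE.
  under [\sum_(p <- r) _ * \sum_(q <- _ :: r) _]eq_bigr => p _ do
    rewrite big_cons mulrDr /=.
  rewrite big_split /=.
  under [\sum_(p <- r) p.2%:~R * (c%:~R * _)]eq_bigr => p _ do
    rewrite mulrCA gdistC //.
  by rewrite -mulr_sumr; ring.
have f22 : form f2 f2 = (wpairs d l)%:~R / 2.
  rewrite /form !f2E wpairsE.
  under eq_bigr => p _ do rewrite f2E.
  under [\sum_(p <- l) _ * f2 _]eq_big_seq => p pl do rewrite f2l // -expr2.
  by field.
have f12 : form f1 f2 = (wsum (d o) l)%:~R.
  by rewrite /form !f1E f2o mulr0 addr0 f2E wsumE.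
have f11 : form f1 f1 = 1 / 2.
  by rewrite /form !f1E gdistxx add0r /f1 eqxx mulr1.
have [p pl p0] : exists2 p, p \in l & p.2 != 0.
  by have /hasP[c /mapP[p pl ->] c0] := l0; exists p.
have := @form_indefinite R _ _ _ d_tr lambda2 (vec f1) (vec f2)
  (enum_rank o) (enum_rank p.1).
rewrite !formE !mxE !enum_rankK f11 f12 f22 f2o f2l // /f1 eqxx intr_eq0 p0.
rewrite oner_eq0 => /(_ isT erefl isT) H.
rewrite /lorentz -(ltr_int R) rmorphM rmorphXn /=.
have := H ltac:(lra); lra.
Qed.
End Form.

End LorentzForm.

(* A small graph is given by the strictly upper triangular part of its adjacency
   matrix: row [i] lists the entries in columns [i + 1], [i + 2], ... *)
Fixpoint adj (M : seq (seq nat)) (i j : nat) : bool :=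
  match M, i, j with
  | r :: _, 0, j'.+1 | r :: _, j'.+1, 0 => 0 < nth 0 r j'
  | _ :: M', i'.+1, j'.+1 => adj M' i' j'
  | _, _, _ => false
  end.

Lemma adj_irr (M : seq (seq nat)) (i : nat) : adj M i i = false.
Proof. by elim: M i => [|r M IH] [|i] //=. Qed.

(* The true distance only when the graph satisfies [adj_conn] below. *)
Definition adj_dist (M : seq (seq nat)) (i j : nat) : nat :=
  if i == j then 0 else if adj M i j then 1
  else if has (fun k => adj M i k && adj M k j) (iota 0 (size M)) then 2 else 3.

Definition adj_conn (M : seq (seq nat)) : bool :=
  let I := iota 0 (size M) in
  allrel (fun i j => (adj_dist M i j == 3) ==>
    has (fun k => has (fun l => [&& adj M i k, adj M k l & adj M l j]) I) I) I I.

(** * Minimal separators, blocks and induced embeddings *)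

Lemma remove_sym (T : finType) (e : rel T) (S : {set T}) :
  symmetric e -> symmetric (remove e S).
Proof. by move=> sym x y; rewrite /remove sym andbCA. Qed.

Lemma separator_sym (T : finType) (e : rel T) (u v : T) (S : {set T}) :
  symmetric e -> separator e u v S = separator e v u S.
Proof.
move=> sym; rewrite /separator andbCA; congr [&& _, _ & ~~ _].
exact/sym_connect_sym/remove_sym.
Qed.

Lemma connect_remove_notin (T : finType) (e : rel T) (S : {set T}) (u x : T) :
  u \notin S -> connect (remove e S) u x -> x \notin S.
Proof.
have clS : closed (remove e S) [predC S].
  by move=> y z /and3P[yS zS _]; rewrite !inE yS zS.
by move=> uS ux; have := closed_connect clS ux; rewrite !inE uS => <-.
Qed.

(** If [s] had no neighbour in the component of [u], putting [s] back would not enlarge that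
    component, and [S :\ s] would still separate. *)
Lemma minset_separator_nbr (T : finType) (e : rel T) (u v s : T) (S : {set T}) :
    symmetric e -> minset (separator e u v) S -> s \in S ->
  exists2 p, connect (remove e S) u p & e s p.
Proof.
move=> sym /minsetP[/and3P[uS vS sepS] minS] sS; apply/exists_inP.
apply: contraT => /exists_inPn no; case/negP: sepS.
have conn_uv : connect (remove e (S :\ s)) u v.
  have : ~~ separator e u v (S :\ s).
    apply: contraTN sS => sep.
    by rewrite -(minS _ sep (subD1set S s)) !inE eqxx.
  by rewrite /separator !inE (negPf uS) (negPf vS) !andbF /= negbK.
pose N := [pred x | connect (remove e S) u x].
rewrite -[connect _ _ _]/(v \in N) -(closed_connect _ conn_uv) ?inE //.
apply: (intro_closed (sym_connect_sym (remove_sym _ sym))) => x y.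
move=> /and3P[_ yS xy] ux; have xS := connect_remove_notin uS ux.
have nys : y != s.
  by apply: contraTneq xy => ->; rewrite sym; exact: no ux.
apply: connect_trans ux (connect1 _); rewrite /remove xS xy andbT /=.
by move: yS; rewrite !inE nys.
Qed.

Lemma universal_connect (T : finType) (e : rel T) (z : T) :
  symmetric e -> (forall x, x != z -> e x z) -> forall x y, connect e x y.
Proof.
move=> sym xz x y; have cz w : connect e w z.
  by have [->|/xz/connect1] := eqVneq w z; first exact: connect0.
by rewrite (connect_trans (cz x)) // sym_connect_sym.
Qed.

(** Deleting [c] leaves [a] or [b], which is still adjacent to all the rest. *)
Lemma universal_no_cut_vertex (T : finType) (e : rel T) (a b c : T) :
  symmetric e -> a != b -> (forall x, x != a -> e x a) ->
  (forall x, x != b -> e x b) -> ~~ cut_vertex e c.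
Proof.
move=> sym nab xa xb; apply/existsPn => x; apply/existsPn => y.
apply/and4P=> -[nxc nyc _ /negP]; apply.
have [z nzc xz] : exists2 z, z != c & forall x, x != z -> e x z.
  have [ac|nac] := eqVneq a c; last by exists a.
  by exists b => //; rewrite -ac eq_sym.
have cz w : w != c -> connect (remove e [set c]) w z.
  move=> nwc; have [->|/xz wz] := eqVneq w z; first exact: connect0.
  by apply: connect1; rewrite /remove !inE nwc nzc wz.
rewrite (connect_trans (cz x nxc)) // sym_connect_sym ?cz //.
exact: remove_sym.
Qed.

(** The predicate maximised in [block], named so that [maxset3] can be applied to it. *)
Definition nonseparable (T : finType) (e : rel T) (C : {set T}) : bool :=
  connected_graph (induced e C) && [forall c, ~~ cut_vertex (induced e C) c].

Lemma universal_nonseparable (T : finType) (e : rel T) (C : {set T}) (a b : T) :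
    symmetric e -> a != b -> a \in C -> b \in C ->
    (forall x, x \in C -> x != a -> e x a) ->
    (forall x, x \in C -> x != b -> e x b) ->
  nonseparable e C.
Proof.
move=> sym nab aC bC xa xb.
pose a' : {x | x \in C} := exist _ a aC; pose b' : {x | x \in C} := exist _ b bC.
have isym : symmetric (induced e C) by move=> x y; apply: sym.
have xa' x : x != a' -> induced e C x a' by move=> nxa; apply: xa (valP x) nxa.
have xb' x : x != b' -> induced e C x b' by move=> nxb; apply: xb (valP x) nxb.
apply/andP; split; last first.
  by apply/forallP => c; apply: universal_no_cut_vertex xa' xb'.
apply/andP; split; first by apply/card_gt0P; exists a'.
by apply/forallP => x; apply/forallP => y; apply: universal_connect xa' _ _.
Qed.

(** The set [A] can be left only through [a]. If [C] contained a vertex outside [a |: A], then [a]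
    would be a cut vertex of [C], or [C] would be disconnected in case it misses [a]. *)
Lemma nonseparable_sub (T : finType) (e : rel T) (C A : {set T}) (a x : T) :
    symmetric e -> (forall y z, y \in A -> e y z -> z != a -> z \in A) ->
    a \notin A -> nonseparable e C -> x \in C -> x \in A ->
  C \subset a |: A.
Proof.
move=> sym clA aA /andP[/andP[_ /forallP conn] /forallP nocut] xC xA.
apply/subsetP => z zC; rewrite !inE; apply: contraT; rewrite negb_or => /andP[nza zA].
pose x' : {x | x \in C} := exist _ x xC; pose z' : {x | x \in C} := exist _ z zC.
have isym : symmetric (induced e C) by move=> u v; apply: sym.
have cxz : connect (induced e C) x' z' by have /forallP := conn x'.
pose N := [pred u : {x | x \in C} | val u \in A].
have [aC|aC] := boolP (a \in C); last first.
  have clN : closed (induced e C) N.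
    apply: (intro_closed (sym_connect_sym isym)) => u v uv; rewrite !inE => uA.
    apply: clA uA uv _; apply: contraNneq aC => <-; exact: valP v.
  by have := closed_connect clN cxz; rewrite !inE /= xA (negPf zA).
pose a' : {x | x \in C} := exist _ a aC.
have nxa : x != a by apply: contraTneq xA => ->.
have := nocut a'; rewrite negb_exists => /forallP/(_ x').
rewrite negb_exists => /forallP/(_ z'); rewrite cxz /= -!val_eqE /= nxa nza negbK.
have clN : closed (remove (induced e C) [set a']) N.
  apply: (intro_closed (sym_connect_sym (remove_sym _ isym))) => u v.
  move=> /and3P[_ va uv]; rewrite !inE => uA; apply: clA uA uv _.
  by move: va; rewrite inE -val_eqE.
by move/(closed_connect clN); rewrite !inE /= xA (negPf zA).
Qed.

Lemma maxset3 (T : finType) (P : pred {set T}) (B0 B1 B2 : {set T}) :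
    P B0 -> P B1 -> P B2 ->
    (forall C, P C -> [|| C \subset B0, C \subset B1 | C \subset B2]) ->
    ~~ (B0 \subset B1) -> ~~ (B0 \subset B2) -> ~~ (B1 \subset B0) ->
    ~~ (B1 \subset B2) -> ~~ (B2 \subset B0) -> ~~ (B2 \subset B1) ->
  [set B | maxset P B] = [set B0; B1; B2] /\ uniq [:: B0; B1; B2].
Proof.
move=> P0 P1 P2 cover n01 n02 n10 n12 n20 n21.
have neq (A B : {set T}) : ~~ (A \subset B) -> A != B.
  by apply: contraNneq => ->.
split; last by rewrite /= !inE negb_or !neq.
apply/setP => B; rewrite !inE; apply/idP/idP => [/maxsetP[PB maxB]|].
  have /or3P[] := cover B PB => sub.
  - by rewrite (maxB _ P0 sub) eqxx.
  - by rewrite (maxB _ P1 sub) eqxx orbT.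
  - by rewrite (maxB _ P2 sub) eqxx orbT.
case/orP=> [/orP[]|] /eqP->; apply/maxsetP; split=> // C PC sub;
  apply/eqP; rewrite eqEsubset sub andbT; have /or3P[] // := cover C PC => sub';
  by have := subset_trans sub sub';
     rewrite ?(negPf n01) ?(negPf n02) ?(negPf n10) ?(negPf n12)
       ?(negPf n20) ?(negPf n21).
Qed.

Lemma embed_conn_induced (T U : finType) (e : rel T) (h : rel U) (g : T -> U) :
  connected_graph e -> injective g -> (forall x y, h (g x) (g y) = e x y) ->
  conn_induced_subgraph e h.
Proof.
move=> /andP[T0 /forallP conn] g_inj hg; pose A := [set g x | x in T].
have gA x : g x \in A by apply: imset_f.
pose f x : {y : U | y \in A} := exist _ (g x) (gA x).
have f_inj : injective f by move=> x y /(congr1 val)/g_inj.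
have f_bij : bijective f.
  by apply: (inj_card_bij f_inj); rewrite card_sig card_imset.
exists A; last by exists f => // x y; apply: hg.
apply/andP; split; first by rewrite -(bij_eq_card f_bij).
have [f' _ f'K] := f_bij; apply/forallP => u; apply/forallP => v.
rewrite -(f'K u) -(f'K v); have /forallP/(_ (f' v)) := conn (f' u).
case/connectP=> s; elim: s (f' u) => [|z s IH] x /=.
  by move=> _ ->; apply: connect0.
case/andP=> xz zs vs; apply: connect_trans (connect1 _) (IH _ zs vs).
by rewrite /induced /= hg.
Qed.

(** * Excluded induced subgraphs *)

Section Lorentz.
Variables (T : finType) (e : rel T).
Hypotheses (e_sym : symmetric e) (e_irr : irreflexive e).
Local Notation d := (gdist e).
Hypothesis d_le3 : forall x y : T, d x y <= 3.
Hypothesis d_lorentz : forall (o : T) (l : seq (T * int)),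
  uniq (o :: unzip1 l) -> has (fun c => c != 0%R) (unzip2 l) -> lorentz d o l.
Hypothesis e_conn : connected_graph e.

Let conn x y : connect e x y.
Proof. by have /andP[_ /forallP/(_ x)/forallP] := e_conn. Qed.

Lemma edge_neq (x y : T) : e x y -> x != y.
Proof. by apply: contraTneq => ->; rewrite e_irr. Qed.

(** A vertex outside the path might be a common neighbour of its ends. Distance 2 would however make
    [lorentz] at [x2] read 6 < 4. *)
Lemma induced_P4_dist (x1 x2 x3 x4 : T) :
    e x1 x2 -> e x2 x3 -> e x3 x4 -> x1 != x3 -> ~~ e x1 x3 ->
    x2 != x4 -> ~~ e x2 x4 -> x1 != x4 -> ~~ e x1 x4 ->
  d x1 x4 = 3.
Proof.
move=> e12 e23 e34 n13 ne13 n24 ne24 n14 ne14.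
have := d_le3 x1 x4; rewrite leq_eqVlt => /predU1P[//|]; rewrite ltnS => le2.
have d14 : d x1 x4 = 2 by apply/eqP; rewrite eqn_leq le2 gdist_gt1.
have := @d_lorentz x2 [:: (x1, -1); (x3, -2); (x4, 1)]%R.
rewrite /lorentz /= !inE [x2 == x1]eq_sym (negPf (edge_neq e12)).
rewrite (negPf (edge_neq e23)) (negPf (edge_neq e34)).
rewrite (negPf n24) (negPf n13) (negPf n14) /=.
rewrite (gdist1 e_irr e23) (gdist1 e_irr e34) (gdistC x2 x1) // (gdist1 e_irr e12).
rewrite (gdist2 e_irr n13 ne13 e12 e23) (gdist2 e_irr n24 ne24 e23 e34) d14.
by move=> /(_ isT isT).
Qed.

(** An entry 0 also asks for distinct vertices; for an edge this follows from irreflexivity. *)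
Fixpoint matches_row (x : T) (vs : seq T) (r : seq nat) : bool :=
  match vs, r with
  | [::], [::] => true
  | y :: vs', b :: r' =>
      (if b is 0 then (x != y) && ~~ e x y else e x y) && matches_row x vs' r'
  | _, _ => false
  end.

Fixpoint matches (vs : seq T) (M : seq (seq nat)) : bool :=
  match vs, M with
  | [::], [::] => true
  | x :: vs', r :: M' => matches_row x vs' r && matches vs' M'
  | _, _ => false
  end.

Lemma matches_rowP x0 x vs r : matches_row x vs r -> forall j, j < size vs ->
  (if 0 < nth 0 r j then e x (nth x0 vs j)
   else (x != nth x0 vs j) && ~~ e x (nth x0 vs j)).
Proof.
elim: vs r => [|y vs IH] [|b r] //= /andP[b_xy /IH IHr] [|j] /= lt_j.
  by case: b b_xy.
exact: IHr.
Qed.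

Lemma matchesP x0 vs M : matches vs M -> forall i j, i < size vs -> j < size vs ->
  i != j -> (if adj M i j then e (nth x0 vs i) (nth x0 vs j)
   else (nth x0 vs i != nth x0 vs j) && ~~ e (nth x0 vs i) (nth x0 vs j)).
Proof.
elim: vs M => [|x vs IH] [|r M] //= /andP[xr /IH IHM] [|i] [|j] //= lti ltj nij.
- exact: matches_rowP xr j ltj.
- by rewrite [e _ x]e_sym eq_sym; exact: matches_rowP xr i lti.
- exact: IHM.
Qed.

Lemma matches_size vs M : matches vs M -> size vs = size M.
Proof. by elim: vs M => [|x vs IH] [|r M] //= /andP[_ /IH ->]. Qed.

Lemma matches_iso (n : nat) (E : seq (nat * nat)) (x0 : T) (vs : seq T)
    (M : seq (seq nat)) (C : {set T}) :
    matches vs M -> C =i vs -> size M = n ->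
    allrel (fun i j => ((i, j) \in E) || ((j, i) \in E) == adj M i j)
      (iota 0 (size M)) (iota 0 (size M)) ->
  graph_iso (@graph_of_edges n E) (induced e C).
Proof.
move=> vsM Cvs szM /allrelP EM; have sz := matches_size vsM.
have lt_sz (i : 'I_n) : i < size vs by rewrite sz szM.
have nthC (i : 'I_n) : nth x0 vs i \in C by rewrite Cvs mem_nth.
pose f (i : 'I_n) : {x | x \in C} := exist _ (nth x0 vs i) (nthC i).
have adjE (i j : 'I_n) : e (nth x0 vs i) (nth x0 vs j) = adj M i j.
  have [->|nij] := eqVneq i j; first by rewrite e_irr adj_irr.
  have := matchesP x0 vsM (lt_sz i) (lt_sz j) nij.
  by case: ifP => [_ ->|_ /andP[_ /negPf]].
have f_inj : injective f.
  move=> i j /(congr1 val) /= fij; apply/eqP; apply: contraT => nij.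
  have := matchesP x0 vsM (lt_sz i) (lt_sz j) nij; rewrite fij eqxx e_irr.
  by case: ifP.
exists f; last first.
  move=> i j; rewrite [LHS]adjE /graph_of_edges; apply/esym/eqP/EM;
    by rewrite mem_iota add0n szM ltn_ord.
apply: inj_card_bij f_inj _; rewrite card_sig card_ord (eq_card Cvs).
by rewrite -szM -sz card_size.
Qed.

(** Here [ids] lists the images of the entries of [vs], and the conditions on it form a closed
    boolean that is decided by computation. The number of vertices is a successor for the sake of
    [inord]. *)
Lemma matches_embed (n : nat) (E : seq (nat * nat)) (vs : seq T) (ids : seq nat)
    (M : seq (seq nat)) :
    matches vs M -> (forall w, w \in vs) ->
    [&& size ids == size M, uniq ids, all (fun i => i < n.+1) ids
      & allrel (fun i j => ((nth 0 ids i, nth 0 ids j) \in E)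
                || ((nth 0 ids j, nth 0 ids i) \in E) == adj M i j)
        (iota 0 (size M)) (iota 0 (size M))] ->
  conn_induced_subgraph e (@graph_of_edges n.+1 E).
Proof.
move=> vsM all_vs /and4P[/eqP sz uids /allP lt_ids /allrelP idsM].
have szv := matches_size vsM.
pose id w := nth 0 ids (index w vs).
have lt_index w : index w vs < size M by rewrite -szv index_mem.
have lt_id w : id w < n.+1 by apply: lt_ids; rewrite mem_nth // sz.
apply: (@embed_conn_induced _ _ _ _ (fun w => inord (id w))) => // x y.
  move=> /(congr1 val) /=; rewrite !inordK // => /eqP.
  rewrite nth_uniq ?sz // => /eqP ixy.
  by rewrite -(nth_index x (all_vs x)) ixy nth_index.
rewrite /graph_of_edges /= !inordK //.
have mI w : index w vs \in iota 0 (size M) by rewrite mem_iota add0n lt_index.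
have /eqP -> := idsM _ _ (mI x) (mI y).
have [ixy|nixy] := eqVneq (index x vs) (index y vs).
  rewrite ixy adj_irr -(nth_index x (all_vs x)) ixy nth_index //.
have := matchesP x vsM _ _ nixy; rewrite !nth_index // !index_mem.
by move=> /(_ (all_vs x) (all_vs y)); case: ifP => [_ ->|_ /andP[_ /negPf->]].
Qed.

Lemma matches_dist x0 vs M i j : matches vs M -> adj_conn M ->
  i < size vs -> j < size vs -> d (nth x0 vs i) (nth x0 vs j) = adj_dist M i j.
Proof.
move=> vsM connM lti ltj; have mP := matchesP x0 vsM.
have sz := matches_size vsM.
rewrite /adj_dist; have [->|nij] := eqVneq i j; first by rewrite gdistxx.
have := mP i j lti ltj nij; case: ifP => [_ /(gdist1 e_irr) //|nad /andP[nx ne]].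
have adjP k l : k < size vs -> l < size vs -> adj M k l ->
    e (nth x0 vs k) (nth x0 vs l).
  move=> ltk ltl a; case: (eqVneq k l) a => [->|nkl a]; first by rewrite adj_irr.
  by have := mP _ _ ltk ltl nkl; rewrite a.
case: ifP => [/hasP[k]|/negbT no2].
  rewrite mem_iota add0n -sz => ltk /andP[/adjP ik /adjP kj].
  exact: (gdist2 e_irr nx ne (ik lti ltk) (kj ltk ltj)).
have dist3 : adj_dist M i j = 3 by rewrite /adj_dist (negPf nij) nad (negPf no2).
have := connM; rewrite /adj_conn => /allrelP/(_ i j).
rewrite !mem_iota !add0n -sz lti ltj dist3 eqxx => /(_ isT isT)/hasP[k].
rewrite mem_iota add0n => ltk /hasP[l]; rewrite mem_iota add0n => ltl.
move=> /and3P[aik akl alj].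
(* With neither an edge nor a common neighbour between its ends, the path through [k] and [l] is an
   induced P4. *)
have notboth m : m < size vs -> ~~ (adj M i m && adj M m j).
  by move=> ltm; move/hasPn: no2; apply; rewrite mem_iota add0n -sz.
have nil : i != l by apply: contraTneq alj => <-; rewrite nad.
have nkj : k != j by apply: contraTneq aik => ->; rewrite nad.
have /andP[xil eil] : (nth x0 vs i != nth x0 vs l) && ~~ e (nth x0 vs i) (nth x0 vs l).
  have := mP _ _ lti ltl nil; have := notboth _ ltl.
  by rewrite alj andbT => /negPf->.
have /andP[xkj ekj] : (nth x0 vs k != nth x0 vs j) && ~~ e (nth x0 vs k) (nth x0 vs j).
  by have := mP _ _ ltk ltj nkj; have := notboth _ ltk; rewrite aik /= => /negPf->.
by apply: (induced_P4_dist (adjP _ _ lti ltk aik) (adjP _ _ ltk ltl akl)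
  (adjP _ _ ltl ltj alj)).
Qed.

(* An induced subgraph of diameter at most 3 is isometric by [induced_P4_dist],
   so a violation of [lorentz] inside it excludes the subgraph itself. *)
Lemma forbidden (vs : seq T) (M : seq (seq nat)) (o : nat) (l : seq (nat * int)) :
    [&& adj_conn M, o < size M, all (fun i => i < size M) (unzip1 l),
        uniq (o :: unzip1 l), has (fun c => c != 0%R) (unzip2 l)
      & ~~ lorentz (adj_dist M) o l] ->
  ~~ matches vs M.
Proof.
move=> /and5P[connM oM lM ul /andP[l0]]; apply: contra => vsM.
have sz := matches_size vsM.
have [x0 _] : exists x0 : T, true by case: vs sz {vsM} oM => [<-|x0]; [|exists x0].
pose f i := nth x0 vs i; have mP := matchesP x0 vsM.
have f_inj i j : i < size M -> j < size M -> f i = f j -> i = j.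
  rewrite -sz => lti ltj fij; apply/eqP; apply: contraPT fij => nij.
  have := mP _ _ lti ltj nij; case: ifP => [_ /edge_neq/eqP //|_].
  by case/andP => /eqP.
have dM i j : i < size M -> j < size M -> d (f i) (f j) = adj_dist M i j.
  by rewrite -sz; apply: matches_dist.
have := @d_lorentz (f o) [seq (f p.1, p.2) | p <- l].
have -> : unzip1 [seq (f p.1, p.2) | p <- l] = map f (unzip1 l).
  by rewrite /unzip1 -!map_comp.
have -> : unzip2 [seq (f p.1, p.2) | p <- l] = unzip2 l by rewrite /unzip2 -map_comp.
rewrite -(map_cons f) map_inj_in_uniq ?ul ?l0; last first.
  have /allP lM' : all (fun i => i < size M) (o :: unzip1 l) by rewrite /= oM.
  by move=> i j /lM' lti /lM' ltj; apply: f_inj.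
have wsumE i r : i < size M -> all (fun j => j < size M) (unzip1 r) ->
    wsum (d (f i)) [seq (f p.1, p.2) | p <- r] = wsum (adj_dist M i) r.
  by move=> ltM; elim: r => //= -[j c] r IH /= /andP[jM /IH ->]; rewrite dM.
move=> /(_ isT isT); rewrite /lorentz wsumE //; congr (_ < _)%R.
elim: l lM {l0 ul} => //= -[j c] r IH /= /andP[jM rM].
by rewrite wsumE // IH.
Qed.

(** Evaluates the adjacencies in the goal from the context, in both orientations; clearing each
    hypothesis makes the loop terminate. *)
Ltac adj_simp := rewrite /=;
  repeat match goal with
  | H : is_true (e ?x ?y) |- _ =>
      rewrite ?H ?(etrans (e_sym y x) H) /=; clear H
  | H : is_true (~~ e ?x ?y) |- _ =>
      rewrite ?(negbTE H) ?(etrans (e_sym y x) (negbTE H)) /=; clear H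
  | H : is_true (?x != ?y) |- _ =>
      rewrite ?(negbTE H) ?(etrans (eq_sym y x) (negbTE H)) /=; clear H
  end.

Lemma no_C4 (x1 x2 x3 x4 : T) :
    e x1 x2 -> e x2 x3 -> e x3 x4 -> e x4 x1 -> x1 != x3 -> ~~ e x1 x3 ->
  x2 != x4 -> e x2 x4.
Proof.
move=> *; apply: contraT => ne24.
(* The last argument line holds the centre and the vector. Here [lorentz] would read 25 < 16, and
   [isT] has this computed. *)
have /negP[] := @forbidden [:: x1; x2; x3; x4]
  [:: [:: 1; 0; 1]; [:: 1; 0]; [:: 1]; [::]]
  0 (zip [:: 1; 2; 3] [:: -2; 1; -2]%Z) isT.
by adj_simp.
Qed.

(** The ends of an induced P4 are at distance 3, so they have no common neighbour. This covers the
    5-cycle and the gem in particular. *)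
Lemma no_hub_P4 (x1 x2 x3 x4 z : T) :
    e x1 x2 -> e x2 x3 -> e x3 x4 -> x1 != x3 -> ~~ e x1 x3 ->
    x2 != x4 -> ~~ e x2 x4 -> x1 != x4 -> e x1 z -> e z x4 -> e x1 x4.
Proof.
move=> e12 e23 e34 n13 ne13 n24 ne24 n14 e1z ez4; apply: contraT => ne14.
have := gdist_le2 n14 e1z ez4 e_irr.
by rewrite (induced_P4_dist e12 e23 e34).
Qed.

(* [P5] has diameter 4, hence is out of reach of [forbidden]. *)
Lemma no_P5 (x1 x2 x3 x4 x5 : T) :
    e x1 x2 -> e x2 x3 -> e x3 x4 -> e x4 x5 -> x1 != x3 -> ~~ e x1 x3 ->
    x2 != x4 -> ~~ e x2 x4 -> x3 != x5 -> ~~ e x3 x5 ->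
    x1 != x4 -> ~~ e x1 x4 -> x2 != x5 -> ~~ e x2 x5 ->
  x1 != x5 -> e x1 x5.
Proof.
move=> e12 e23 e34 e45 n13 ne13 n24 ne24 n35 ne35 n14 ne14 n25 ne25 n15.
apply: contraT => ne15.
have P4 := induced_P4_dist.
have d14 := P4 _ _ _ _ e12 e23 e34 n13 ne13 n24 ne24 n14 ne14.
have d25 := P4 _ _ _ _ e23 e34 e45 n24 ne24 n35 ne35 n25 ne25.
have d12 := gdist1 e_irr e12; have d45 := gdist1 e_irr e45.
have d24 := gdist2 e_irr n24 ne24 e23 e34.
have n12 := edge_neq e12; have n45 := edge_neq e45.
(* In the whole graph the ends are at distance 2 or 3. Each value has its own vector, for which
   [lorentz] reads 3 < 0 and 17 < 16 respectively. *)
have := d_le3 x1 x5; rewrite leq_eqVlt => /predU1P[d15|]; last first.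
  rewrite ltnS => le2; have d15 : d x1 x5 = 2.
    by apply/eqP; rewrite eqn_leq le2 gdist_gt1.
  have := @d_lorentz x1 [:: (x2, -1); (x4, 1); (x5, -1)]%R.
  rewrite /lorentz /= d12 d14 d15 d24 d25 d45 !inE !negb_or.
  by rewrite n12 n14 n15 n24 n25 n45 => /(_ isT isT).
have := @d_lorentz x2 [:: (x1, 2); (x4, 3); (x5, -2)]%R.
rewrite /lorentz /= (gdistC x2 x1) // d12 d14 d15 d24 d25 d45 !inE !negb_or.
by rewrite [x2 == x1]eq_sym n12 n14 n15 n24 n25 n45 => /(_ isT isT).
Qed.

(** * The neighbourhood of a diamond *)

Definition diamond_at (a b p q : T) : bool :=
  [&& e a b, e a p, e b p, e a q, e b q, p != q & ~~ e p q].

Lemma diamond_swap a b p q : diamond_at a b p q -> diamond_at b a p q.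
Proof.
move=> /and5P[ab ap bp aq /and3P[bq npq nepq]].
by rewrite /diamond_at e_sym ab ap bp aq bq npq.
Qed.

Lemma diamond_sym a b p q : diamond_at a b p q -> diamond_at a b q p.
Proof.
move=> /and5P[ab ap bp aq /and3P[bq npq nepq]].
by rewrite /diamond_at ab ap bp aq bq eq_sym npq e_sym.
Qed.

(** A vertex [w] adjacent to both [p] and [q] is adjacent to [a] and [b] by [no_C4], which gives
    [K_5] minus an edge. If [w] misses [q] and exactly one of [a], [b], an induced P4 from [q] to
    [w] has ends with a common neighbour. If it misses all three, it is pendant at [p]. All of these
    are excluded. *)
Lemma diamond_nbr a b p q w : diamond_at a b p q -> e w p -> w != a -> w != b ->
  [&& e a w, e b w, w != q & ~~ e w q].
Proof.
move=> /and5P[ab ap bp aq /and3P[bq npq nepq]] wp nwa nwb.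
have nwq : w != q by apply: contraTneq wp => ->; rewrite e_sym.
rewrite nwq; have [wq|nwq'] /= := boolP (e w q).
  have wa : e w a.
    by apply: (@no_C4 p w q a) => //; rewrite 1?e_sym // eq_sym.
  have wb : e w b.
    by apply: (@no_C4 p w q b) => //; rewrite 1?e_sym // eq_sym.
  have /negP[] := @forbidden [:: a; b; p; q; w]
    [:: [:: 1; 1; 1; 1]; [:: 1; 1; 1]; [:: 0; 1]; [:: 1]; [::]]
    0 (zip [:: 1; 2; 3; 4] [:: -1; 1; 1; -1]%Z) isT.
  by adj_simp.
rewrite andbT ![e _ w]e_sym.
have [wa|nwa'] := boolP (e w a); have [wb|nwb'] := boolP (e w b) => //=.
- have : e q w; last by adj_simp.
  by apply: (@no_hub_P4 q b p w a); adj_simp.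
- have : e q w; last by adj_simp.
  by apply: (@no_hub_P4 q a p w b); adj_simp.
- have /negP[] := @forbidden [:: a; b; p; q; w]
   [:: [:: 1; 1; 1; 0]; [:: 1; 1; 0]; [:: 0; 1]; [:: 0]; [::]]
   2 (zip [:: 0; 1; 3; 4] [:: -1; -1; 1; -1]%Z) isT.
  by adj_simp.
Qed.

Lemma diamond_nbr_excl a b v u u' :
  e a v -> e b v -> diamond_at a b u u' -> e v u -> ~~ e v u'.
Proof.
move=> av bv D vu; have := diamond_nbr D vu.
by rewrite [v == a]eq_sym [v == b]eq_sym (edge_neq av) (edge_neq bv)
  => /(_ isT isT)/and4P[].
Qed.

(** Adjacency to both contradicts [diamond_nbr]; adjacency to neither gives an edge joined to three
    independent vertices, which is excluded. *)
Lemma diamond_third_adj a b p q v : diamond_at a b p q ->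
  e a v -> e b v -> v != p -> v != q -> e v p = ~~ e v q.
Proof.
move=> D av bv nvp nvq; have [vp|nvp'] := boolP (e v p).
  by rewrite (diamond_nbr_excl av bv D).
apply/esym/negP => /negP nvq'; have [ab ap bp aq /and3P[bq npq nepq]] := and5P D.
have /negP[] := @forbidden [:: a; b; p; q; v]
   [:: [:: 1; 1; 1; 1]; [:: 1; 1; 1]; [:: 0; 0]; [:: 0]; [::]]
   0 (zip [:: 1; 2; 3; 4] [:: 1; -1; -1; -1]%Z) isT.
by adj_simp.
Qed.

Lemma diamond_common a b p q v : diamond_at a b p q -> e a v -> e b v ->
  exists q', diamond_at a b v q'.
Proof.
move=> D av bv; have [->|nvp] := eqVneq v p; first by exists q.
have [->|nvq] := eqVneq v q; first by exists p; apply: diamond_sym.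
have := diamond_third_adj D av bv nvp nvq.
move: D => /and5P[ab ap bp aq /and3P[bq npq nepq]].
have [vp /esym vq|vp /esym/negbFE vq] := boolP (e v p).
  by exists q; rewrite /diamond_at; adj_simp.
by exists p; rewrite /diamond_at; adj_simp.
Qed.

Lemma diamond_common_nbr a b p q v w : diamond_at a b p q -> e a v -> e b v ->
  e v w -> w != a -> w != b -> e a w && e b w.
Proof.
move=> D av bv vw nwa nwb; have [q' D'] := diamond_common D av bv.
by rewrite e_sym in vw; have /and4P[-> ->] := diamond_nbr D' vw nwa nwb.
Qed.

(** Otherwise neither [v] nor [w] is adjacent to [p] or [q], and the six vertices form a diamond
    with a tail of two edges at [a], which is excluded. *)
Lemma diamond_side_closed a b p q v w : diamond_at a b p q ->
  e a v -> e v w -> w != a -> w != b -> e a w || e b w.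
Proof.
move=> D av vw nwa nwb; have [bv|nbv] := boolP (e b v).
  by have /andP[->] := diamond_common_nbr D av bv vw nwa nwb.
apply: contraT; rewrite negb_or => /andP[naw nbw].
have far x q' : diamond_at a b x q' -> e x v || e x w -> False.
  move=> D' xvw; have /and5P[_ ax bx _ _] := D'.
  case/orP: xvw => [xv|xw]; last first.
    by have := diamond_common_nbr D ax bx xw nwa nwb; rewrite (negPf naw).
  have := diamond_common_nbr D ax bx xv; rewrite (negPf nbv) andbF.
  rewrite [v == a]eq_sym edge_neq // => /(_ isT) H.
  have /eqP vb : v == b by apply: contraT => /H.
  by rewrite vb (negPf nbw) in vw.
have := far _ _ D; have := far _ _ (diamond_sym D).
case pv : (e p v); first by move=> _ /(_ isT).
case pw : (e p w); first by move=> _ /(_ isT).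
case qv : (e q v); first by move=> /(_ isT).
case qw : (e q w); first by move=> /(_ isT).
move: pv pw qv qw => /negbT pv /negbT pw /negbT qv /negbT qw _ _.
move: D => /and5P[ab ap bp aq /and3P[bq npq nepq]].
have neq u z t : e u z -> ~~ e u t -> t != z by move=> uz; apply: contraNneq => ->.
have nvp := neq _ _ _ bp nbv; have nvq := neq _ _ _ bq nbv.
have nwp := neq _ _ _ ap naw; have nwq := neq _ _ _ aq naw.
have nvb : v != b by apply: contraTneq vw => ->.
have /negP[] := @forbidden [:: a; b; p; q; v; w]
  [:: [:: 1; 1; 1; 1; 0]; [:: 1; 1; 0; 0]; [:: 0; 0; 0]; [:: 0; 0]; [:: 1]; [::]]
  0 (zip [:: 1; 2; 3; 4; 5] [:: -1; 1; 1; 2; -1]%Z) isT.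
by adj_simp.
Qed.

Lemma diamond_dominates a b p q w : diamond_at a b p q ->
  [|| w == a, w == b, e a w | e b w].
Proof.
move=> D; pose N := [pred w | [|| w == a, w == b, e a w | e b w]].
have clN : closed e N.
  apply: (intro_closed (sym_connect_sym e_sym)) => v u vu.
  rewrite !inE => /or4P[/eqP va|/eqP vb|av|bv].
  - by rewrite -va vu !orbT.
  - by rewrite -vb vu !orbT.
  - have [//|nua] := eqVneq u a; have [//|nub] := eqVneq u b => /=.
    exact: diamond_side_closed D av vu nua nub.
  - have [//|nua] := eqVneq u a; have [//|nub] := eqVneq u b => /=.
    by rewrite orbC; apply: diamond_side_closed (diamond_swap D) bv vu nub nua.
by have := closed_connect clN (conn a w); rewrite !inE eqxx.
Qed.

(** * From a minimal separator to a diamond *)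

Lemma separator_component (u v a b x y : T) (S : {set T}) :
    S = [set a; b] -> separator e u v S ->
    connect (remove e S) u x -> connect (remove e S) v y ->
  [/\ x != a, x != b, x != y & ~~ e x y].
Proof.
move=> defS /and3P[uS vS sep] ux vy.
have xS := connect_remove_notin uS ux; have yS := connect_remove_notin vS vy.
have csym := sym_connect_sym (remove_sym S e_sym).
have := xS; rewrite {1}defS !inE negb_or => /andP[-> ->]; split=> //.
  by apply: contraNneq sep => xy; rewrite (connect_trans ux) // csym xy.
apply: contra sep => xy; rewrite (connect_trans ux) // csym.
rewrite (connect_trans vy) // connect1 //.
by rewrite /remove xS yS e_sym xy.
Qed.

(** Otherwise some path [a], [p], [p1], [b] through the component of [u] is induced up to the edge
    [ab]. With that edge it closes to a C4. Without it, a neighbour [q] of [a] in the component of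
    [v] either extends it to a P5 or is a common neighbour of its ends. *)
Lemma separator_common_nbr (u v a b : T) (S : {set T}) :
    a != b -> S = [set a; b] -> minset (separator e u v) S ->
  exists p, [/\ connect (remove e S) u p, e a p & e b p].
Proof.
move=> nab defS minS; have [sep _] := minsetP minS.
have [uS vS _] := and3P sep.
have aS : a \in S by rewrite defS !inE eqxx.
have bS : b \in S by rewrite defS !inE eqxx orbT.
have K_sym := remove_sym S e_sym; have csym := sym_connect_sym K_sym.
have [p0 up0 ap0] := minset_separator_nbr e_sym minS aS.
have [p1 up1 bp1] := minset_separator_nbr e_sym minS bS.
have minS' : minset (separator e v u) S.
  by rewrite (minset_eq (P2 := separator e u v)) // => A; apply: separator_sym.
have [q vq aq] := minset_separator_nbr e_sym minS' aS.
have far x : connect (remove e S) u x -> [/\ x != a, x != b, x != q & ~~ e x q].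
  by move=> ux; apply: separator_component ux vq.
have [/existsP[p /and3P[up ap bp]]|/existsPn none] :=
  boolP [exists p, [&& connect (remove e S) u p, e a p & e b p]].
  by exists p.
have none' p : connect (remove e S) u p -> e a p -> ~~ e b p.
  by move=> up ap; have := none p; rewrite up ap.
(* As [P5] is excluded, the component of [u] stays within distance 2 of [a]. *)
pose Y := [pred x | connect (remove e S) u x &&
  (e a x || [exists p, [&& connect (remove e S) u p, e a p & e p x]])].
have clY : closed (remove e S) Y.
  apply: (intro_closed csym) => x y Kxy; rewrite !inE => /andP[ux ax].
  have uy := connect_trans ux (connect1 Kxy); rewrite uy /=.
  have [//|nay] := boolP (e a y) => /=; have [_ _ xy] := and3P Kxy.
  case: (boolP (e a x)) ax => [ax _|nax /= /existsP[p /and3P[up ap px]]].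
    by apply/existsP; exists x; rewrite ux ax.
  have [py|npy] := boolP (e p y).
    by apply/existsP; exists p; rewrite up ap.
  have [xa xb xq nxq] := far x ux; have [ya yb yq nyq] := far y uy.
  have [pa pb pq npq] := far p up.
  have npy' : p != y by apply: contraTneq ap => ->.
  case/negP: nyq; rewrite e_sym.
  by apply: (@no_P5 q a p x y); rewrite // 1?e_sym // eq_sym.
have p0Y : p0 \in Y by rewrite !inE up0 ap0.
have conn01 : connect (remove e S) p0 p1 by rewrite (connect_trans _ up1) // csym.
have := closed_connect clY conn01; rewrite p0Y !inE up1 /= => /esym.
have nap1 : ~~ e a p1 by apply: contraL bp1; apply: none'.
rewrite (negPf nap1) => /existsP[p /and3P[up ap pp1]].
have nbp := none' p up ap.
have [pa pb pq npq] := far p up; have [p1a p1b p1q np1q] := far p1 up1.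
case/negP: nbp; have [ab|nab'] := boolP (e a b).
  by rewrite e_sym; apply: (@no_C4 a p p1 b) => //; rewrite 1?e_sym // eq_sym.
have bq : e b q.
  have nbp : ~~ e p b by rewrite e_sym none'.
  have qb : q != b by apply: contraTneq bS => <-; exact: connect_remove_notin vq.
  by rewrite e_sym; apply: (@no_P5 q a p p1 b); rewrite // 1?e_sym // eq_sym.
have nbp : ~~ e p b by rewrite e_sym none'.
case/negP: nab'; apply: (@no_hub_P4 a p p1 b q) => //; rewrite 1?e_sym //.
by rewrite eq_sym.
Qed.

(** Common neighbours of [a] and [b] in different components are nonadjacent, so the 4-cycle they
    form with [a] and [b] needs the chord [ab]. *)
Lemma mvs_diamond (S : {set T}) : mvs e S -> #|S| = 2 ->
  exists a b p q, diamond_at a b p q.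
Proof.
move=> /existsP[u /existsP[v /and3P[_ _ minS]]] /eqP/cards2P[a [b [nab defS]]].
have [p [up ap bp]] := separator_common_nbr nab defS minS.
have minS' : minset (separator e v u) S.
  by rewrite (minset_eq (P2 := separator e u v)) // => A; apply: separator_sym.
have [q [vq aq bq]] := separator_common_nbr nab defS minS'.
have [sep _] := minsetP minS.
have [pa pb pq npq] := separator_component defS sep up vq.
exists a, b, p, q; rewrite /diamond_at ap bp aq bq pq npq !andbT.
by apply: (@no_C4 p a q b) => //; rewrite 1?e_sym.
Qed.

(** By [diamond_third_adj] each of [c], [c'] is adjacent to exactly one of [p], [q]. Up to symmetry,
    either [diamond_nbr_excl] fails for another diamond on [ab], or the edge [ab] is joined to
    [K_3 + K_1] or to [K_2 + K_2], both excluded. *)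
Lemma diamond_third_nbr a b p q c c' : diamond_at a b p q ->
  e a c -> e b c -> e a c' -> e b c' -> c != p -> c != q -> c' != p -> c' != q ->
  c = c'.
Proof.
move=> D ac bc ac' bc' ncp ncq nc'p nc'q; apply/eqP; apply: contraT => ncc'.
have [ab ap bp aq /and3P[bq npq nepq]] := and5P D.
have nbr v u u' : e a v -> e b v -> diamond_at a b u u' -> e v u -> ~~ e v u'.
  by move=> av bv D' vu; apply: diamond_nbr_excl D' vu.
have one v : e a v -> e b v -> v != p -> v != q -> e v p = ~~ e v q.
  by move=> av bv; apply: diamond_third_adj D av bv.
wlog cp : p q D ap bp aq bq npq nepq ncp ncq nc'p nc'q one / e c p.
  move=> H; have [cp|ncp'] := boolP (e c p); first exact: (H p q).
  apply: (H q p) => //; [exact: diamond_sym | by rewrite eq_sym | by rewrite e_sym | |].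
    by move=> v *; rewrite one // negbK.
  by move: ncp'; rewrite one // negbK.
have ncq' : ~~ e c q by rewrite -one.
have [c'p|nc'p'] := boolP (e c' p).
  have nc'q' : ~~ e c' q by rewrite -one.
  have [cc'|ncc2] := boolP (e c c').
    have /negP[] := @forbidden [:: a; b; p; q; c; c']
      [:: [:: 1; 1; 1; 1; 1]; [:: 1; 1; 1; 1]; [:: 0; 1; 1]; [:: 0; 0]; [:: 1]; [::]]
      0 (zip [:: 1; 2; 3; 4; 5] [:: 3; -1; -2; -1; -1]%Z) isT.
    by adj_simp.
  have : ~~ e p c'; last by rewrite e_sym c'p.
  by apply: (nbr p c c') => //; [rewrite /diamond_at; adj_simp | rewrite e_sym].
have c'q : e c' q by move: nc'p'; rewrite one // negbK.
have [cc'|ncc2] := boolP (e c c').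
  have : ~~ e c' q; last by rewrite c'q.
  by apply: (nbr c' c q) => //; [rewrite /diamond_at; adj_simp | rewrite e_sym].
have /negP[] := @forbidden [:: a; b; p; q; c; c']
  [:: [:: 1; 1; 1; 1; 1]; [:: 1; 1; 1; 1]; [:: 0; 1; 0]; [:: 0; 1]; [:: 0]; [::]]
  0 (zip [:: 1; 2; 3; 4; 5] [:: 2; -1; -1; -1; -1]%Z) isT.
by adj_simp.
Qed.

(** The third common neighbour, if any, is adjacent to exactly one of [p] and [q]; that one is named
    [p']. In a full house, [q'] is then the vertex outside the [K_4]. *)
Lemma diamond_orient a b p q : diamond_at a b p q ->
  exists p' q', diamond_at a b p' q' /\
    forall c, e a c -> e b c -> c != p' -> c != q' -> e p' c && ~~ e q' c.
Proof.
move=> D; have [/existsP[c /and5P[ac bc ncp ncq]]|/existsPn none] := boolP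
    [exists c, [&& e a c, e b c, c != p, c != q & ~~ (e p c && ~~ e q c)]].
  have := diamond_third_adj D ac bc ncp ncq; rewrite ![e c _]e_sym => pc npc.
  exists q, p; split; first exact: diamond_sym.
  move=> c' ac' bc' nc'q nc'p.
  rewrite -(diamond_third_nbr D ac bc ac' bc' ncp ncq nc'p nc'q).
  by move: npc; rewrite pc; case: (e q c).
exists p, q; split=> // c ac bc ncp ncq.
by have := none c; rewrite ac bc ncp ncq /= negbK.
Qed.

(** * Vertices adjacent to only one end of the edge *)

Definition side (a b : T) : {set T} := [set x | [&& e a x, ~~ e b x & x != b]].

Lemma sideP a b x : reflect [/\ e a x, ~~ e b x & x != b] (x \in side a b).
Proof. by rewrite inE; apply: and3P. Qed.

Lemma side_common a b p q x v : diamond_at a b p q -> x \in side a b ->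
  e a v -> e b v -> ~~ e x v.
Proof.
move=> D /sideP[ax nbx nxb] av bv; apply: contra nbx => xv.
rewrite e_sym in xv; have := diamond_common_nbr D av bv xv _ nxb.
by rewrite eq_sym edge_neq // => /(_ isT)/andP[].
Qed.

Lemma side_side a b x y : e a b -> x \in side a b -> y \in side b a -> ~~ e x y.
Proof.
move=> ab /sideP[ax nbx nxb] /sideP[yb nay nya]; apply: contra nbx => xy.
rewrite e_sym; apply: (@no_C4 a x y b) => //; rewrite 1?e_sym //.
by rewrite eq_sym.
Qed.

Section Side.
Variables (a b y : T).
Hypotheses (ab : e a b) (yb : y \in side b a).

(** An induced path on three vertices in the side of [a] is excluded together with [a], [b] and [y].
    A side is therefore a disjoint union of cliques, and [side_no_triple] bounds their number by
    two. *)
Lemma side_trans x w u : x \in side a b -> w \in side a b -> u \in side a b ->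
  e x w -> e w u -> x != u -> e x u.
Proof.
move=> xa wa ua xw wu nxu; apply: contraT => nxu'.
have xy := side_side ab xa yb; have wy := side_side ab wa yb.
have uy := side_side ab ua yb.
have nxw := edge_neq xw; have nwu := edge_neq wu.
move: xa wa ua yb => /sideP[ax bx xb] /sideP[aw bw wb] /sideP[au bu ub].
case/sideP=> by_ ay ya.
have neq z : e a z -> y != z by move=> az; apply: contraNneq ay => ->.
have nyx := neq _ ax; have nyw := neq _ aw; have nyu := neq _ au.
have /negP[] := @forbidden [:: a; b; y; x; w; u]
  [:: [:: 1; 0; 1; 1; 1]; [:: 1; 0; 0; 0]; [:: 0; 0; 0]; [:: 1; 0]; [:: 1]; [::]]
  0 (zip [:: 1; 2; 3; 4; 5] [:: 2; -1; 2; -2; 2]%Z) isT.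
by adj_simp.
Qed.

Lemma side_no_triple x w u : x \in side a b -> w \in side a b -> u \in side a b ->
  x != w -> w != u -> x != u -> [|| e x w, e w u | e x u].
Proof.
move=> xa wa ua nxw nwu nxu; apply: contraT; rewrite !negb_or => /and3P[xw wu xu].
have xy := side_side ab xa yb; have wy := side_side ab wa yb.
have uy := side_side ab ua yb.
move: xa wa ua yb => /sideP[ax bx xb] /sideP[aw bw wb] /sideP[au bu ub].
case/sideP=> by_ ay ya.
have neq z : e a z -> y != z by move=> az; apply: contraNneq ay => ->.
have nyx := neq _ ax; have nyw := neq _ aw; have nyu := neq _ au.
have /negP[] := @forbidden [:: a; b; y; x; w; u]
  [:: [:: 1; 0; 1; 1; 1]; [:: 1; 0; 0; 0]; [:: 0; 0; 0]; [:: 0; 0]; [:: 0]; [::]]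
  0 (zip [:: 1; 2; 3; 4; 5] [:: 2; -1; 1; 1; 1]%Z) isT.
by adj_simp.
Qed.

(** Two nonadjacent vertices at [a] and two vertices at [b] are excluded, whether or not the latter
    are adjacent. *)
Lemma side_clique2 v x w : v \in side b a -> x \in side a b -> w \in side a b ->
  y != v -> x != w -> e x w.
Proof.
move=> vb xa wa nyv nxw; apply: contraT => xw.
have xy := side_side ab xa yb; have wy := side_side ab wa yb.
have xv := side_side ab xa vb; have wv := side_side ab wa vb.
move: xa wa yb vb => /sideP[ax bx xb] /sideP[aw bw wb].
move=> /sideP[by_ ay ya] /sideP[bv av va].
have neq z u : e a z -> ~~ e a u -> u != z by move=> az; apply: contraNneq => ->.
have nyx := neq _ _ ax ay; have nyw := neq _ _ aw ay.
have nvx := neq _ _ ax av; have nvw := neq _ _ aw av.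
have [yv|yv] := boolP (e y v).
  have /negP[] := @forbidden [:: a; b; x; w; y; v]
    [:: [:: 1; 1; 1; 0; 0]; [:: 0; 0; 1; 1]; [:: 0; 0; 0]; [:: 0; 0]; [:: 1]; [::]]
    0 (zip [:: 1; 2; 3; 4; 5] [:: 4; 1; 1; -1; -1]%Z) isT.
  by adj_simp.
have /negP[] := @forbidden [:: a; b; x; w; y; v]
  [:: [:: 1; 1; 1; 0; 0]; [:: 0; 0; 1; 1]; [:: 0; 0; 0]; [:: 0; 0]; [:: 0]; [::]]
  0 (zip [:: 1; 2; 3; 4; 5] [:: 3; 1; 1; -1; -1]%Z) isT.
by adj_simp.
Qed.

Lemma side_third_adj x w u : x \in side a b -> w \in side a b -> u \in side a b ->
    x != w -> ~~ e x w -> u != x -> u != w -> e x u = ~~ e w u.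
Proof.
move=> xa wa za nxw nexw nzx nzw; have [xz|nxz] := boolP (e x u).
  apply/esym/negP => wz; case/negP: nexw.
  by apply: (side_trans xa za wa xz) => //; rewrite e_sym.
apply/esym/negPn; have := side_no_triple xa wa za nxw.
by rewrite [w == u]eq_sym [x == u]eq_sym nzx nzw (negPf nexw) (negPf nxz) orbF; apply.
Qed.

(** Every further vertex joins the clique of [x] or that of [w]; two of them would make the side
    contain [K_3 + K_1] or [K_2 + K_2], both excluded in the presence of [y]. *)
Lemma side_third x w u v : x \in side a b -> w \in side a b -> u \in side a b ->
    v \in side a b -> x != w -> ~~ e x w -> u != x -> u != w -> v != x -> v != w ->
  u = v.
Proof.
move=> xa wa ua va nxw nexw nux nuw nvx nvw; apply/eqP; apply: contraT => nuv.
have one z : z \in side a b -> z != x -> z != w -> e x z = ~~ e w z.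
  by move=> za; apply: side_third_adj.
wlog xu : x w xa wa nxw nexw nux nuw nvx nvw one / e x u.
  move=> H; have [xu|] := boolP (e x u); first exact: (H x w).
  rewrite one // negbK => wu; apply: (H w x) => //; rewrite 1?eq_sym 1?e_sym //.
  by move=> z za nzw nzx; rewrite one // negbK.
have nwu : ~~ e w u by rewrite -one.
have xy := side_side ab xa yb; have wy := side_side ab wa yb.
have uy := side_side ab ua yb; have vy := side_side ab va yb.
have [xv|nxv] := boolP (e x v).
  have nwv : ~~ e w v by rewrite -one.
  have uv : e u v by apply: (side_trans ua xa va) => //; rewrite e_sym.
  move: xa wa ua va yb => /sideP[ax bx xb] /sideP[aw bw wb] /sideP[au bu ub].
  move=> /sideP[av bv vb] /sideP[by_ ay ya].
  have neq z : e a z -> y != z by move=> az; apply: contraNneq ay => ->.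
  have nyx := neq _ ax; have nyw := neq _ aw; have nyu := neq _ au.
  have nyv := neq _ av.
  have /negP[] := @forbidden [:: a; b; y; x; u; v; w]
    [:: [:: 1; 0; 1; 1; 1; 1]; [:: 1; 0; 0; 0; 0]; [:: 0; 0; 0; 0];
        [:: 1; 1; 0]; [:: 1; 0]; [:: 0]; [::]]
    0 (zip [:: 1; 2; 3; 4; 5; 6] [:: 6; -3; 1; 1; 1; 2]%Z) isT.
  by adj_simp.
have wv : e w v by move: nxv; rewrite one // negbK.
have nuv' : ~~ e u v.
  by apply: contra nxv => uv; apply: (side_trans xa ua va) => //; rewrite eq_sym.
move: xa wa ua va yb => /sideP[ax bx xb] /sideP[aw bw wb] /sideP[au bu ub].
move=> /sideP[av bv vb] /sideP[by_ ay ya].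
have neq z : e a z -> y != z by move=> az; apply: contraNneq ay => ->.
have nyx := neq _ ax; have nyw := neq _ aw; have nyu := neq _ au.
have nyv := neq _ av.
have /negP[] := @forbidden [:: a; b; y; x; u; w; v]
  [:: [:: 1; 0; 1; 1; 1; 1]; [:: 1; 0; 0; 0; 0]; [:: 0; 0; 0; 0];
      [:: 1; 0; 0]; [:: 0; 0]; [:: 1]; [::]]
  0 (zip [:: 1; 2; 3; 4; 5; 6] [:: 4; -2; 1; 1; 1; 1]%Z) isT.
by adj_simp.
Qed.
End Side.

(** With an empty side at [a], [diamond_dominates] makes [b] adjacent to all other vertices, and the
    diameter is at most 2. *)
Lemma side_nonempty a b p q : diamond_at a b p q -> 2 < diam e ->
  exists x, x \in side a b.
Proof.
move=> D gt2; apply/set0Pn; apply: contraL gt2 => /eqP A0.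
have nbr_b w : w != b -> e b w.
  move=> nwb; have [ab _ _ _ _] := and5P D.
  have := diamond_dominates w D.
  rewrite (negPf nwb) /= => /or3P[/eqP->||//]; first by rewrite e_sym.
  move=> aw; apply: contraT => nbw.
  by have := in_set0 w; rewrite -A0 inE aw nbw nwb.
rewrite -leqNgt; apply/bigmax_leqP => x _; apply/bigmax_leqP => z _.
have [->|nxz] := eqVneq x z; first by rewrite gdistxx.
have [xb|nxb] := eqVneq x b.
  by rewrite xb gdist1 // nbr_b // -xb eq_sym.
have [zb|nzb] := eqVneq z b.
  by rewrite zb gdistC // gdist1 // nbr_b.
by apply: (gdist_le2 nxz _ (nbr_b _ nzb)) => //; rewrite e_sym nbr_b.
Qed.

(** * A side that is not a clique: embedding in [Pt1] *)

Lemma nonadj_common_side a b p q v x : diamond_at a b p q -> x \in side a b ->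
  e a v -> e b v -> (v != x) && ~~ e v x.
Proof.
move=> D xa av bv; rewrite e_sym (side_common D xa) //.
rewrite andbT; case/sideP: xa => _ nbx _.
by apply: contraNneq nbx => <-.
Qed.

Lemma nonadj_side_side a b x y : e a b -> x \in side a b -> y \in side b a ->
  (x != y) && ~~ e x y.
Proof.
move=> ab xa yb; rewrite (side_side ab xa yb).
rewrite andbT; case/sideP: xa => ax _ _; case/sideP: yb => _ nay _.
by apply: contraNneq nay => <-.
Qed.

Lemma nonadj_apex_side a b x : x \in side a b -> (b != x) && ~~ e b x.
Proof. by case/sideP=> _ -> nxb; rewrite eq_sym nxb. Qed.

Lemma Pt1_embedding a b p q x y1 y2 : diamond_at a b p q ->
    x \in side a b -> (forall w, w \in side a b -> w = x) ->
    y1 \in side b a -> y2 \in side b a -> y1 != y2 -> ~~ e y1 y2 ->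
  conn_induced_subgraph e Pt1.
Proof.
move=> D xa only_x y1b y2b ny12 ney12.
(* The two names are exchanged: here [q] is the one adjacent to a third common neighbour, and [p]
   takes the place of the vertex t of [Pt1]. *)
have [q0 [p0 [/(diamond_sym) D0 qc]]] :=
  diamond_orient D.
move: p0 q0 D0 qc {p q D} => p q D qc; have [ab _] := andP D.
have third u v : u \in side b a -> v \in side b a -> u != y1 -> u != y2 ->
    v != y1 -> v != y2 -> u = v.
  move=> ub vb; rewrite e_sym in ab.
  exact: (side_third ab xa y1b y2b ub vb ny12 ney12).
have thirdC c c' : e a c -> e b c -> e a c' -> e b c' ->
    c != p -> c != q -> c' != p -> c' != q -> c = c'.
  by move=> *; apply: (diamond_third_nbr D).
(* A third vertex of the side is adjacent to exactly one of [y1], [y2]. Naming that one [y2] makes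
   [y1] the pendant vertex and puts [y2] in the triangle of [Pt1]. *)
wlog : y1 y2 y1b y2b ny12 ney12 third /
    (forall y3, y3 \in side b a -> y3 != y1 -> y3 != y2 -> e y2 y3).
  move=> H; have [/existsP[y3 /and4P[y3b n31 n32 y23]]|/existsPn none] := boolP
    [exists y3, [&& y3 \in side b a, y3 != y1, y3 != y2 & ~~ e y2 y3]].
    apply: (H y2 y1) => //; rewrite 1?eq_sym 1?e_sym //; first by auto.
    move=> y4 y4b n42 n41; rewrite -(third _ _ y3b y4b) //.
    rewrite e_sym in ab; have := side_third_adj ab xa
      y1b y2b y3b ny12 ney12 n31 n32.
    by rewrite y23.
  apply: (H y1 y2) => // y3 y3b n31 n32.
  by have := none y3; rewrite y3b n31 n32 /= negbK.
move=> y23.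
have [_ ap bp aq /and3P[bq npq nepq]] := and5P D.
have ax : e a x by case/sideP: xa.
have by1 : e b y1 by case/sideP: y1b.
have by2 : e b y2 by case/sideP: y2b.
have bx := nonadj_apex_side xa; have ay1 := nonadj_apex_side y1b.
have ay2 := nonadj_apex_side y2b.
have pq : (p != q) && ~~ e p q by rewrite npq.
have y12 : (y1 != y2) && ~~ e y1 y2 by rewrite ny12.
have Dx v := @nonadj_common_side a b p q v x D xa.
have Db : diamond_at b a p q := diamond_swap D.
have Dy v y yb av bv := @nonadj_common_side b a p q v y Db yb bv av.
have xy y := @nonadj_side_side a b x y ab xa.
have all_vs w : [|| w == a, w == b, w == p, w == q, w == x, w == y1, w == y2,
    [&& e a w, e b w, w != p & w != q] | [&& w \in side b a, w != y1 & w != y2]].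
  have := diamond_dominates w D.
  have [//|nwa] := eqVneq w a; have [//|nwb] := eqVneq w b; rewrite /=.
  have [aw|naw] := boolP (e a w); have [bw|nbw] := boolP (e b w) => //= _.
  - by case: (w == p); case: (w == q); rewrite ?orbT.
  - by rewrite (only_x w) ?eqxx ?orbT // inE aw nbw nwb.
  - have -> : w \in side b a by rewrite inE bw naw nwa.
    by case: (w == y1); case: (w == y2); rewrite ?orbT.
have adj3 y3 : y3 \in side b a -> y3 != y1 -> y3 != y2 -> e y1 y3 = ~~ e y2 y3.
  move=> y3b n31 n32; rewrite e_sym in ab.
  exact: (side_third_adj ab xa y1b y2b y3b ny12 ney12
    n31 n32).
(* Nonadjacencies are kept in the conjunctive form that [matches_row] tests for an entry 0, so that
   this tuple rewrites every [matches] goal below. *)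
pose base := (ab, ap, bp, aq, bq, ax, by1, by2, bx, (ay1, ay2, pq, y12),
  (Dx p ap bp, Dx q aq bq, Dy p _ y1b ap bp, Dy p _ y2b ap bp),
  (Dy q _ y1b aq bq, Dy q _ y2b aq bq, xy _ y1b, xy _ y2b)).
(* [a], [b], [p], [q], [c], [x], [y1], [y2], [y3] are mapped to the vertices
   p, r, t, o, q, s, x, y, z of [Pt1]. *)
have [y3|no3] := pickP [pred y3 | [&& y3 \in side b a, y3 != y1 & y3 != y2]];
  have [c|noc] := pickP [pred c | [&& e a c, e b c, c != p & c != q]].
- move=> /and4P[ac bc ncp ncq] /and3P[y3b n31 n32].
  have /andP[qc' npc] := qc c ac bc ncq ncp.
  have pc : (p != c) && ~~ e p c by rewrite eq_sym ncp.
  have by3 : e b y3 by case/sideP: y3b.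
  have ay3 := nonadj_apex_side y3b.
  have e23 := y23 y3 y3b n31 n32.
  have y13 : (y1 != y3) && ~~ e y1 y3.
    by rewrite (adj3 y3 y3b n31 n32) e23 eq_sym n31.
  apply: (@matches_embed 8 _ [:: a; b; p; q; c; x; y1; y2; y3]
    [:: 1; 3; 4; 0; 2; 5; 6; 7; 8]
    [:: [:: 1; 1; 1; 1; 1; 0; 0; 0]; [:: 1; 1; 1; 0; 1; 1; 1]; [:: 0; 0; 0; 0; 0; 0];
        [:: 1; 0; 0; 0; 0]; [:: 0; 0; 0; 0]; [:: 0; 0; 0]; [:: 0; 0]; [:: 1]; [::]])
    => //.
    rewrite /= !base !(ac, bc, pc, qc', Dx c ac bc, Dy c _ y1b ac bc).
    rewrite !(Dy c _ y2b ac bc, by3, ay3, e23, y13, xy _ y3b).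
    by rewrite !(Dy p _ y3b ap bp, Dy q _ y3b aq bq, Dy c _ y3b ac bc).
  move=> w; have := all_vs w; rewrite !in_cons in_nil orbF.
  move=> /or4P[->|->|->|]; rewrite ?orbT // => /or4P[->|->|->|]; rewrite ?orbT //.
  case/or3P=> [->|/and4P[aw bw nwp nwq]|/and3P[wb n1 n2]]; rewrite ?orbT //.
    by rewrite (thirdC w c) // eqxx ?orTb !orbT.
  by rewrite (third w y3) // eqxx !orbT.
- move=> /and3P[y3b n31 n32].
  have by3 : e b y3 by case/sideP: y3b.
  have ay3 := nonadj_apex_side y3b.
  have e23 := y23 y3 y3b n31 n32.
  have y13 : (y1 != y3) && ~~ e y1 y3.
    by rewrite (adj3 y3 y3b n31 n32) e23 eq_sym n31.
  apply: (@matches_embed 8 _ [:: a; b; p; q; x; y1; y2; y3]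
    [:: 1; 3; 4; 0; 5; 6; 7; 8]
    [:: [:: 1; 1; 1; 1; 0; 0; 0]; [:: 1; 1; 0; 1; 1; 1]; [:: 0; 0; 0; 0; 0];
        [:: 0; 0; 0; 0]; [:: 0; 0; 0]; [:: 0; 0]; [:: 1]; [::]]) => //.
    rewrite /= !base !(by3, ay3, e23, y13, xy _ y3b).
    by rewrite !(Dy p _ y3b ap bp, Dy q _ y3b aq bq).
  move=> w; have := all_vs w; rewrite !in_cons in_nil orbF.
  move=> /or4P[->|->|->|]; rewrite ?orbT // => /or4P[->|->|->|]; rewrite ?orbT //.
  case/or3P=> [->|/and4P[aw bw nwp nwq]|/and3P[wb n1 n2]]; rewrite ?orbT //.
    by have := noc w; rewrite /= aw bw nwp nwq.
  by rewrite (third w y3) // eqxx !orbT.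
- move=> /and4P[ac bc ncp ncq].
  have /andP[qc' npc] := qc c ac bc ncq ncp.
  have pc : (p != c) && ~~ e p c by rewrite eq_sym ncp.
  apply: (@matches_embed 8 _ [:: a; b; p; q; c; x; y1; y2]
    [:: 1; 3; 4; 0; 2; 5; 6; 7]
    [:: [:: 1; 1; 1; 1; 1; 0; 0]; [:: 1; 1; 1; 0; 1; 1]; [:: 0; 0; 0; 0; 0];
        [:: 1; 0; 0; 0]; [:: 0; 0; 0]; [:: 0; 0]; [:: 0]; [::]]) => //.
    rewrite /= !base !(ac, bc, pc, qc', Dx c ac bc).
    by rewrite !(Dy c _ y1b ac bc, Dy c _ y2b ac bc).
  move=> w; have := all_vs w; rewrite !in_cons in_nil orbF.
  move=> /or4P[->|->|->|]; rewrite ?orbT // => /or4P[->|->|->|]; rewrite ?orbT //.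
  case/or3P=> [->|/and4P[aw bw nwp nwq]|/and3P[wb n1 n2]]; rewrite ?orbT //.
    by rewrite (thirdC w c) // eqxx ?orTb !orbT.
  by have := no3 w; rewrite /= wb n1 n2.
- apply: (@matches_embed 8 _ [:: a; b; p; q; x; y1; y2]
    [:: 1; 3; 4; 0; 5; 6; 7]
    [:: [:: 1; 1; 1; 1; 0; 0]; [:: 1; 1; 0; 1; 1]; [:: 0; 0; 0; 0];
        [:: 0; 0; 0]; [:: 0; 0]; [:: 0]; [::]]) => //.
    by rewrite /= !base.
  move=> w; have := all_vs w; rewrite !in_cons in_nil orbF.
  move=> /or4P[->|->|->|]; rewrite ?orbT // => /or4P[->|->|->|]; rewrite ?orbT //.
  case/or3P=> [->|/and4P[aw bw nwp nwq]|/and3P[wb n1 n2]]; rewrite ?orbT //.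
    by have := noc w; rewrite /= aw bw nwp nwq.
  by have := no3 w; rewrite /= wb n1 n2.
Qed.

(** * Both sides are cliques: the three blocks *)

Section TripleBlock.
Variables (a b p q x y : T).
Local Notation A := (side a b).
Local Notation B := (side b a).
Hypotheses (D : diamond_at a b p q) (xA : x \in A) (yB : y \in B).
Hypothesis third_nbr : forall c, e a c -> e b c -> c != p -> c != q ->
  e p c && ~~ e q c.
Hypothesis A_clique : forall x w, x \in A -> w \in A -> x != w -> e x w.
Hypothesis B_clique : forall x w, x \in B -> w \in B -> x != w -> e x w.

Let C := ~: (A :|: B).

Let e_ab : e a b. Proof. by case/andP: D. Qed.
Let neq_ab : a != b. Proof. exact: (edge_neq e_ab). Qed.

Lemma in_core w : (w \in C) = [|| w == a, w == b | e a w && e b w].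
Proof.
rewrite !inE; have := diamond_dominates w D.
have [->|nwa] := eqVneq w a; first by rewrite e_irr /= ?andbF.
have [->|nwb] := eqVneq w b; first by rewrite e_irr /= ?andbF ?orbT.
by case: (e a w); case: (e b w).
Qed.

Lemma apex_notin_sides : [/\ a \notin A, b \notin A, a \notin B & b \notin B].
Proof. by rewrite !inE !e_irr !eqxx !andbF. Qed.

(** Edges to common neighbours are barred by [side_common], edges to the other side by [side_side].
    This is the closure that [nonseparable_sub] asks for. *)
Lemma side_closedA u v : u \in A -> e u v -> v != a -> v \in A.
Proof.
move=> uA uv nva; have /sideP[au nbu nub] := uA.
have nvb : v != b by apply: contraTneq uv => ->; rewrite e_sym.
have := diamond_dominates v D; rewrite (negPf nva) (negPf nvb) /=.
have [av|nav] := boolP (e a v); have [bv|nbv] := boolP (e b v) => //= _.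
- by have := side_common D uA av bv; rewrite uv.
- by rewrite inE av nbv.
- have vB : v \in B by rewrite inE bv nav.
  by have := side_side e_ab uA vB; rewrite uv.
Qed.

Lemma side_closedB u v : u \in B -> e u v -> v != b -> v \in B.
Proof.
move=> uB uv nvb; have /sideP[bu nau nua] := uB.
have nva : v != a by apply: contraTneq uv => ->; rewrite e_sym.
have := diamond_dominates v D; rewrite (negPf nva) (negPf nvb) /=.
have [av|nav] := boolP (e a v); have [bv|nbv] := boolP (e b v) => //= _.
- by have := side_common (diamond_swap D) uB bv av; rewrite uv.
- have vA : v \in A by rewrite inE av nbv.
  by have := side_side e_ab vA uB; rewrite e_sym uv.
- by rewrite inE bv nav.
Qed.

Lemma core_nonseparable : nonseparable e C.
Proof.
apply: (universal_nonseparable e_sym neq_ab); rewrite ?in_core ?eqxx ?orbT //.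
  move=> w; rewrite in_core => /or3P[/eqP->|/eqP-> _|/andP[aw _] _].
  - by rewrite eqxx.
  - by rewrite e_sym.
  - by rewrite e_sym.
move=> w; rewrite in_core => /or3P[/eqP->|/eqP->|/andP[_ bw] _] //.
- by rewrite eqxx.
- by rewrite e_sym.
Qed.

Lemma side_cliqueU u v (S := side u v) :
  (forall x w, x \in S -> w \in S -> x != w -> e x w) ->
  forall x w, x \in u |: S -> w \in u |: S -> x != w -> e x w.
Proof.
move=> clS z w; rewrite !in_setU1 => /predU1P[->|zS] /predU1P[->|wS] nzw.
- by rewrite eqxx in nzw.
- by case/sideP: wS.
- by rewrite e_sym; case/sideP: zS.
- exact: clS.
Qed.

Lemma side_nonseparable u v z (S := side u v) : z \in S ->
  (forall x w, x \in S -> w \in S -> x != w -> e x w) -> nonseparable e (u |: S).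
Proof.
move=> zS /side_cliqueU cl; have uS : u \in u |: S by rewrite setU11.
have zS' : z \in u |: S by rewrite setU1r.
have nuz : u != z by case/sideP: zS => /edge_neq.
by apply: (universal_nonseparable e_sym nuz uS zS') => w wS; apply: cl.
Qed.

(** A nonseparable set that is not inside the core meets a side, and [nonseparable_sub] then
    confines it to that side and its apex. The vertices [p], [x] and [y] witness the
    non-inclusions. *)
Lemma core_blocks :
  [set S | block e S] = [set C; a |: A; b |: B] /\ uniq [:: C; a |: A; b |: B].
Proof.
have [aA bA aB bB] := apex_notin_sides.
have [ap bp] : e a p /\ e b p by case/and5P: D.
have pC : p \in C by rewrite in_core ap bp !orbT.
have pA : p \notin a |: A.
  by rewrite !inE bp andbF orbF eq_sym (edge_neq ap).
have pB : p \notin b |: B.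
  by rewrite !inE ap andbF orbF eq_sym (edge_neq bp).
have xC : x \notin C by rewrite !inE negbK; move: xA; rewrite inE => ->.
have yC : y \notin C by rewrite !inE negbK orbC; move: yB; rewrite inE => ->.
have nsub (U V : {set T}) w : w \in U -> w \notin V -> ~~ (U \subset V).
  by move=> wU; apply: contra => /subsetP/(_ w wU).
have xB : x \notin b |: B.
  by rewrite !inE; case/sideP: xA => _ /negPf-> /negPf->.
have yA : y \notin a |: A.
  by rewrite !inE; case/sideP: yB => _ /negPf-> /negPf->.
apply: maxset3; [exact: core_nonseparable | exact: side_nonseparable xA A_clique
  | exact: side_nonseparable yB B_clique | |
  exact: nsub pC pA | exact: nsub pC pB | exact: nsub (setU1r _ xA) xC
  | exact: nsub (setU1r _ xA) xB | exact: nsub (setU1r _ yB) yC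
  | exact: nsub (setU1r _ yB) yA].
move=> S nsS; have [|sub] := boolP (S \subset C); first by [].
have [z zS] := subsetPn sub; rewrite inE negbK inE => /orP[zA|zB].
  by rewrite (nonseparable_sub e_sym side_closedA aA nsS zS zA).
by rewrite (nonseparable_sub e_sym side_closedB bB nsS zS zB) orbT.
Qed.

(** By [diamond_third_nbr] the core is [a], [b], [p], [q] and at most one more vertex [c]; in the
    latter case [a], [b], [p], [c] form the [K_4] of the full house. *)
Lemma core_iso : graph_iso full_house (induced e C) \/ graph_iso diamond (induced e C).
Proof.
have [ab ap bp aq /and3P[bq npq nepq]] := and5P D.
have pq : (p != q) && ~~ e p q by rewrite npq.
have [c|noc] := pickP [pred c | [&& e a c, e b c, c != p & c != q]].
  move=> /and4P[ac bc ncp ncq]; left; have /andP[pc nqc] := third_nbr ac bc ncp ncq.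
  have cq : (c != q) && ~~ e c q by rewrite ncq e_sym.
  apply: (@matches_iso 5 _ a [:: a; b; p; c; q]
    [:: [:: 1; 1; 1; 1]; [:: 1; 1; 1]; [:: 1; 0]; [:: 0]; [::]]) => //.
    by rewrite /= !(ab, ap, ac, aq, bp, bc, bq, pc, pq, cq).
  move=> w; rewrite in_core !in_cons in_nil orbF.
  have [//|nwa] := eqVneq w a; have [//|nwb] := eqVneq w b => /=.
  have [->|nwp] := eqVneq w p; first by rewrite ap bp.
  have [->|nwq] := eqVneq w q; first by rewrite aq bq orbT.
  rewrite orbF /=; apply/idP/eqP => [/andP[aw bw]|->]; last by rewrite ac bc.
  exact: (diamond_third_nbr D).
right; apply: (@matches_iso 4 _ a [:: a; b; p; q]
    [:: [:: 1; 1; 1]; [:: 1; 1]; [:: 0]; [::]]) => //.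
  by rewrite /= !(ab, ap, aq, bp, bq, pq).
move=> w; rewrite in_core !in_cons in_nil orbF.
have [//|nwa] := eqVneq w a; have [//|nwb] := eqVneq w b => /=.
have [->|nwp] := eqVneq w p; first by rewrite ap bp.
have [->|nwq] := eqVneq w q; first by rewrite aq bq.
by apply/negP => /andP[aw bw]; have := noc w; rewrite /= aw bw nwp nwq.
Qed.

(** Without [a] and [b], the vertex [q] is isolated in the core, since a third common neighbour is
    attached to [p] only. Both are needed, each being a common neighbour of [p] and [q]. *)
Lemma core_mvs : exists2 S : {set {w | w \in C}},
  mvs (induced e C) S & val @: S = [set a; b].
Proof.
have [ab ap bp aq /and3P[bq npq nepq]] := and5P D.
have [aC bC] : a \in C /\ b \in C by rewrite !in_core !eqxx ?orbT.
have [pC qC] : p \in C /\ q \in C by rewrite !in_core ap bp aq bq !orbT.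
pose a' : {w | w \in C} := exist _ a aC; pose b' : {w | w \in C} := exist _ b bC.
pose p' : {w | w \in C} := exist _ p pC; pose q' : {w | w \in C} := exist _ q qC.
have isym : symmetric (induced e C) by move=> u v; apply: e_sym.
exists [set a'; b']; last by rewrite imsetU1 imset_set1.
have neqs : [/\ p' \notin [set a'; b'], q' \notin [set a'; b'] & q' != p'].
  rewrite !inE -!val_eqE /= ![p == _]eq_sym ![q == _]eq_sym.
  rewrite !negb_or npq !(edge_neq ap, edge_neq bp).
  by rewrite (edge_neq aq) (edge_neq bq).
have [pS qS nqp'] := neqs.
apply/existsP; exists q'; apply/existsP; exists p'; rewrite nqp'.
rewrite /= {1}/induced /= e_sym nepq; apply/minsetP; split.
  apply/and3P; split=> //; apply/negP.
  have clq : closed (remove (induced e C) [set a'; b']) (pred1 q').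
    apply: (intro_closed (sym_connect_sym (remove_sym _ isym))) => u v.
    move=> /and3P[_ vS uv] /eqP uq; move: uv vS; rewrite uq /induced /= => qv.
    rewrite !inE -!val_eqE /= negb_or => /andP[nva nvb].
    have := valP v; rewrite in_core (negPf nva) (negPf nvb) /= => /andP[av bv].
    have nvq : val v != q by apply: contraTneq qv => ->; rewrite e_irr.
    have nvp : val v != p by apply: contraTneq qv => ->; rewrite e_sym.
    by have := third_nbr av bv nvp nvq; rewrite qv andbF.
  by move/(closed_connect clq); rewrite !inE eqxx eq_sym (negPf nqp').
move=> S /and3P[qS' pS' sepS] subS; apply/eqP; rewrite eqEsubset subS /=.
have mid z : induced e C q' z -> induced e C z p' -> z \in S.
  move=> qz zp; apply: contraR sepS => zS.
  by apply: (@connect_trans _ _ z); apply: connect1; rewrite /remove ?qS' ?pS' zS.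
apply/subsetP => z; rewrite !inE => /orP[] /eqP->; apply: mid;
  by rewrite /induced //= e_sym.
Qed.

Lemma triple_block : triple_block_graph #|A|.+1 #|B|.+1 e.
Proof.
have [aA bA aB bB] := apex_notin_sides.
have cliqueU u v (S := side u v) : u \notin S ->
    (forall x w, x \in S -> w \in S -> x != w -> e x w) ->
    clique e (u |: S) /\ #|u |: S| = #|S|.+1.
  move=> uS /side_cliqueU cl; split; last by rewrite cardsU1 uS.
  by apply/forall_inP => z zS; apply/forall_inP => w wS; apply/implyP; apply: cl.
have coreI u v (S := side u v) : S = A \/ S = B -> u \notin S -> u \in C ->
    C :&: (u |: S) = [set u].
  move=> SAB uS uC; apply/setP => w; rewrite in_setI in_setU1 in_set1.
  have [->|_] := eqVneq w u; first by rewrite uC.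
  by case: SAB => ->; rewrite inE in_setU; case: (w \in A); case: (w \in B).
split=> //.
exists C, (a |: A), (b |: B); split.
- exact: core_blocks.
- exact: core_iso.
- exact: cliqueU.
- exact: cliqueU.
have [S mvsS valS] := core_mvs; exists S => //; exists a, b; split=> //.
- by apply: coreI => //; [left | rewrite in_core eqxx].
- by apply: coreI => //; [right | rewrite in_core eqxx orbT].
Qed.
End TripleBlock.

(** * The case distinction and the conclusion *)

Lemma side_not_clique a b : ~~ clique e (side a b) ->
  exists x y, [/\ x \in side a b, y \in side a b, x != y & ~~ e x y].
Proof.
rewrite negb_forall_in => /exists_inP[x xA]; rewrite negb_forall_in.
by case/exists_inP=> y yA; rewrite negb_imply => /andP[nxy nexy]; exists x, y.
Qed.

Lemma Pt1_or_triple_block (S : {set T}) : mvs e S -> #|S| = 2 -> 2 < diam e ->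
  conn_induced_subgraph e Pt1 \/
  exists p q : nat, [/\ 2 <= p, 2 <= q & triple_block_graph p q e].
Proof.
move=> mvsS S2 diam2; have [a [b [p0 [q0 D0]]]] := mvs_diamond mvsS S2.
have pt1 a' b' p' q' : diamond_at a' b' p' q' -> ~~ clique e (side b' a') ->
    conn_induced_subgraph e Pt1.
  move=> D /side_not_clique[y1 [y2 [y1B y2B ny12 ney12]]].
  have [x xA] := side_nonempty D diam2; have [ab _] := andP D.
  apply: (Pt1_embedding D xA _ y1B y2B ny12 ney12).
  (* By [side_clique2], a second vertex on this side would make [y1] and [y2] adjacent. *)
  move=> w wA; apply/eqP; apply: contraR ney12; rewrite eq_sym => nxw.
  by rewrite e_sym in ab; apply: (side_clique2 ab xA wA y1B y2B nxw ny12).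
have [clA|/(pt1 _ _ _ _ (diamond_swap D0))] := boolP (clique e (side a b));
  last by left.
have [clB|/(pt1 _ _ _ _ D0)] := boolP (clique e (side b a)); last by left.
right; have [p [q [D third]]] := diamond_orient D0.
have [x xA] := side_nonempty D diam2.
have [y yB] := side_nonempty (diamond_swap D) diam2.
have cl u v : clique e (side u v) ->
    forall z w, z \in side u v -> w \in side u v -> z != w -> e z w.
  by move=> /forall_inP cl z w zS wS; have /forall_inP/(_ w wS)/implyP := cl z zS.
have gt1 u v z : z \in side u v -> 1 < #|side u v|.+1.
  by move=> zS; rewrite ltnS card_gt0; apply/set0Pn; exists z.
exists #|side a b|.+1, #|side b a|.+1.
split; [exact: gt1 xA | exact: gt1 yB |].
by apply: (triple_block D xA yB third); apply: cl.
Qed.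

End Lorentz.

Local Open Scope ring_scope.

Theorem theorem3 (R : rcfType) (T : finType) (e : rel T)
  (e_simple : simple_graph e)
  (e_conn : connected_graph e)
  (e_diam : diam e = 3%N)
  (e_mvs : exists S : {set T}, mvs e S /\ #|S| = 2%N)
  (e_lambda2 : dist_lambda R 2 e < - (1 / 2)) :
  conn_induced_subgraph e Pt1 \/
  exists p q : nat, [/\ (2 <= p)%N, (2 <= q)%N &
    exists (U : finType) (h : rel U),
      triple_block_graph p q h /\ conn_induced_subgraph e h].
Proof.
have [e_sym e_irr] := e_simple; have [S [mvsS S2]] := e_mvs.
have d_le3 x y : (gdist e x y <= 3)%N by rewrite -e_diam leq_diam.
have d_lor := lambda2_lorentz e_sym e_lambda2.
have [||[p [q [p_ge2 q_ge2 tbg]]]] :=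
  Pt1_or_triple_block e_sym e_irr d_le3 d_lor e_conn mvsS S2.
- by rewrite e_diam.
- by left.
(* The graph is itself a triple block graph, so the embedding is the identity. *)
right; exists p, q; split=> //; exists T, e; split=> //.
exact: (@embed_conn_induced _ _ _ _ id).
Qed.
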